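(* For any complex numbers $z_1,\dots,z_n$ and any nonzero complex number $\hbar$, the subalgebra $\mathcal{B}^S_{n,\hbar}(z_1,\dots,z_n)$ of $\mathbb{C}[\mathfrak{S}_n]$ is commutative.
   Context: $\mathfrak{S}_n$ is the symmetric group; $\sigma_{a,b}$ is the transposition of $a$ and $b$; permutations are multiplied as functions (right factor acts first). $A^{[m]}=\frac1{m!}\sum_{\sigma\in\mathfrak{S}_m}\mathrm{sign}(\sigma)\,\sigma$. We view $\mathfrak{S}_n\subset\mathfrak{S}_{n+m}$ as the permutations fixing $n+1,\dots,n+m$, and $\vartheta_m:\mathbb{C}[\mathfrak{S}_m]\to\mathbb{C}[\mathfrak{S}_{n+m}]$ is the embedding induced by $i\mapsto n+i$. For $p\in\mathbb{C}$ the linear map $\mathrm{Tr}^{(p)}_m:\mathbb{C}[\mathfrak{S}_{n+m}]\to\mathbb{C}[\mathfrak{S}_n]$ is defined as follows: for $\sigma\in\mathfrak{S}_{n+m}$ written as a product of disjoint cycles, delete all symbols $>n$ and read the result as $\tau\in\mathfrak{S}_n$; let $c(\sigma)$, $c(\tau)$ be the numbers of orbits of $\sigma$ on $\{1,\dots,n+m\}$ and of $\tau$ on $\{1,\dots,n\}$; then $\mathrm{Tr}^{(p)}_m(\sigma)=p^{c(\sigma)-c(\tau)}\tau$ (with $p^0=1$). It is applied coefficientwise to polynomials in $u$. For $m\ge1$ put $$T^{[n]}_m(u;p;\hbar)=\mathrm{Tr}^{(p)}_m\Bigl(\vartheta_m(A^{[m]})\bigl(u-z_n+\hbar\sum_{i=1}^m\sigma_{n,n+i}\bigr)\cdots\bigl(u-z_1+\hbar\sum_{i=1}^m\sigma_{1,n+i}\bigr)\Bigr)=\sum_{i=0}^nT^{[n]}_{m,i}(p;\hbar)u^{n-i}.$$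 $\mathcal{B}^S_{n,\hbar}(z_1,\dots,z_n)$ is the unital subalgebra of $\mathbb{C}[\mathfrak{S}_n]$ generated by all $T^{[n]}_{m,i}(p;\hbar)$, $m=1,\dots,n-1$, $i=1,\dots,n$, for a given $p$; it does not depend on $p$. *)

(* Defs.v *)
From HB Require Import structures.
From mathcomp Require Import all_boot all_order all_algebra all_fingroup all_field.

Set Implicit Arguments.
Unset Strict Implicit.
Unset Printing Implicit Defensive.

Import GRing.Theory.

Local Open Scope ring_scope.

(* The group algebra F[S_n], as functions on 'S_n with the convolution product.
   MathComp composes permutations left to right, [(s * t)%g x = t (s x)]; the
   product below is the one for the opposite convention, in which permutations
   are multiplied as functions: see [pbasisM] and [pcompE]. *)
Definition permalg (F : fieldType) (n : nat) : Type := {ffun 'S_n -> F^o}.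

Definition pcomp (n : nat) (s t : 'S_n) : 'S_n := (t * s)%g.

Lemma pcompE n (s t : 'S_n) x : pcomp s t x = s (t x).
Proof. exact: permM. Qed.

Section PermAlgebra.
Variables (F : fieldType) (n : nat).
Local Notation A := (permalg F n).

HB.instance Definition _ := Vector.copy A {ffun 'S_n -> F^o}.

Definition pbasis (s : 'S_n) : A := [ffun t => (t == s)%:R].

Definition permalg_mul (x y : A) : A :=
  \sum_(s : 'S_n) \sum_(t : 'S_n) (x s * y t) *: pbasis (pcomp s t).

Lemma permalgD (x y : A) s : (x + y) s = x s + y s.
Proof. exact: ffunE. Qed.

Lemma permalgZ c (x : A) s : (c *: x) s = c * x s.
Proof. exact: ffunE. Qed.

Lemma permalg_sumE (I : Type) (r : seq I) (P : pred I) (f : I -> A) s :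
  (\sum_(i <- r | P i) f i) s = \sum_(i <- r | P i) f i s.
Proof.
by elim/big_rec2: _ => [|i a b _ <-]; [exact: ffunE | exact: permalgD].
Qed.

Lemma pbasisE s t : pbasis s t = (t == s)%:R.
Proof. exact: ffunE. Qed.

Lemma permalg_expand (x : A) : x = \sum_(s : 'S_n) x s *: pbasis s.
Proof.
apply/ffunP=> t; rewrite permalg_sumE (bigD1 t) //= permalgZ pbasisE eqxx mulr1.
rewrite big1 ?addr0 // => s nst.
by rewrite permalgZ pbasisE eq_sym (negPf nst) mulr0.
Qed.

Lemma permalg_mulE (x y : A) u :
  permalg_mul x y u = \sum_(s : 'S_n) x s * y (u * s^-1)%g.
Proof.
rewrite permalg_sumE; apply: eq_bigr => s _.
rewrite permalg_sumE (bigD1 (u * s^-1)%g) //= permalgZ pbasisE /pcomp mulgKV eqxx.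
rewrite mulr1 big1 ?addr0 // => t nt; rewrite permalgZ pbasisE.
have [def_u|_] := eqVneq; last by rewrite mulr0.
by rewrite def_u mulgK eqxx in nt.
Qed.

Fact permalg_mulA : associative permalg_mul.
Proof.
move=> x y z; apply/ffunP=> u; rewrite !permalg_mulE.
under eq_bigr do rewrite permalg_mulE big_distrr /=.
under [RHS]eq_bigr do rewrite permalg_mulE big_distrl /=.
rewrite [RHS]exchange_big /=; apply: eq_bigr => s _.
rewrite [RHS](reindex_inj (mulIg s)) /=; apply: eq_bigr => t _.
by rewrite mulgK invMg mulgA mulrA.
Qed.

Fact permalg_mul1 : left_id (pbasis 1%g) permalg_mul.
Proof.
move=> x; apply/ffunP=> u; rewrite permalg_mulE (bigD1 1%g) //= pbasisE eqxx mul1r.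
rewrite invg1 mulg1 big1 ?addr0 // => s ns.
by rewrite pbasisE (negPf ns) mul0r.
Qed.

Fact permalg_mulr1 : right_id (pbasis 1%g) permalg_mul.
Proof.
move=> x; apply/ffunP=> u; rewrite permalg_mulE (bigD1 u) //= pbasisE mulgV eqxx.
rewrite mulr1 big1 ?addr0 // => s ns; rewrite pbasisE -eq_mulgV1 eq_sym.
by rewrite (negPf ns) mulr0.
Qed.

Fact permalg_mulDl : left_distributive permalg_mul +%R.
Proof.
move=> x y z; apply/ffunP=> u; rewrite permalgD !permalg_mulE -big_split.
by apply: eq_bigr => s _; rewrite permalgD mulrDl.
Qed.

Fact permalg_mulDr : right_distributive permalg_mul +%R.
Proof.
move=> x y z; apply/ffunP=> u; rewrite permalgD !permalg_mulE -big_split.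
by apply: eq_bigr => s _; rewrite permalgD mulrDr.
Qed.

Fact permalg_1neq0 : pbasis 1%g != 0 :> A.
Proof.
apply/eqP=> /ffunP/(_ 1%g)/eqP; rewrite pbasisE eqxx.
by rewrite ffunE oner_eq0.
Qed.

HB.instance Definition _ := GRing.Zmodule_isNzRing.Build A
  permalg_mulA permalg_mul1 permalg_mulr1 permalg_mulDl permalg_mulDr
  permalg_1neq0.

Fact permalg_scaleAl c (x y : A) : c *: (x * y) = (c *: x) * y.
Proof.
apply/ffunP=> u; rewrite permalgZ [in LHS]permalg_mulE [in RHS]permalg_mulE.
by rewrite big_distrr; apply: eq_bigr => s _; rewrite permalgZ /= mulrA.
Qed.

HB.instance Definition _ := GRing.Lmodule_isLalgebra.Build F A permalg_scaleAl.

Fact permalg_scaleAr c (x y : A) : c *: (x * y) = x * (c *: y).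
Proof.
apply/ffunP=> u; rewrite permalgZ [in LHS]permalg_mulE [in RHS]permalg_mulE.
by rewrite big_distrr; apply: eq_bigr => s _; rewrite permalgZ /= mulrCA.
Qed.

HB.instance Definition _ := GRing.Lalgebra_isAlgebra.Build F A permalg_scaleAr.
HB.instance Definition _ := Algebra_isFalgebra.Build F A.

Lemma pbasisM (s t : 'S_n) : pbasis s * pbasis t = pbasis (pcomp s t).
Proof.
apply/ffunP=> u; rewrite [LHS]permalg_mulE (bigD1 s) //= big1 => [|v nv].
  by rewrite !pbasisE eqxx mul1r addr0 /pcomp (can2_eq (mulgKV s) (mulgK s)).
by rewrite !pbasisE (negPf nv) mul0r.
Qed.

End PermAlgebra.

Section Bethe.
Variable F : fieldType.

Definition antisym (m : nat) : permalg F m :=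
  (m`!%:R)^-1 *: \sum_(s : 'S_m) (-1) ^+ s *: pbasis F s.

Section Shift.
Variables n m : nat.

Definition shift_fun (s : 'S_m) (k : 'I_(n + m)) : 'I_(n + m) :=
  match split k with
  | inl a => lshift m a
  | inr i => rshift n (s i)
  end.

Fact shift_fun_inj s : injective (shift_fun s).
Proof.
move=> j k; rewrite /shift_fun; case: (split_ordP j) => a ->.
all: case: (split_ordP k) => b -> /eqP.
all: rewrite ?eq_lshift ?eq_rshift ?eq_lrshift ?eq_rlshift //.
  by move=> /eqP ->.
by move=> /eqP/perm_inj ->.
Qed.

Definition shift_perm (s : 'S_m) : 'S_(n + m) := perm (@shift_fun_inj s).

Definition theta (x : permalg F m) : permalg F (n + m) :=
  \sum_(s : 'S_m) x s *: pbasis F (shift_perm s).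

End Shift.

Section Trace.
Variables n m : nat.

(* The cycle of [s] through the symbol [a] of {1, ..., n}, with all symbols
   outside {1, ..., n} deleted. *)
Definition trunc_cycle (s : 'S_(n + m)) (a : 'I_n) : seq 'I_n :=
  pmap insub [seq val k | k <- fingraph.orbit s (lshift m a)].

Lemma mem_trunc_cycle s a b :
  (b \in trunc_cycle s a) = (lshift m b \in porbit s (lshift m a)).
Proof.
rewrite mem_pmap_sub -[val b]/(val (lshift m b)) mem_map; last exact: val_inj.
rewrite -fconnect_orbit; apply/idP/idP.
  by move/iter_findex => <-; rewrite -permX mem_porbit.
by case/porbitP=> i ->; rewrite permX fconnect_iter.
Qed.

Lemma trunc_cycle_uniq s a : uniq (trunc_cycle s a).
Proof.
by apply: pmap_sub_uniq; rewrite map_inj_uniq ?orbit_uniq //; apply: val_inj.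
Qed.

Lemma trunc_cycle_next s a b : b \in trunc_cycle s a ->
  next (trunc_cycle s b) =1 next (trunc_cycle s a).
Proof.
rewrite mem_trunc_cycle => /porbitP[j def_b].
have s_b: lshift m b \in fingraph.orbit s (lshift m a).
  by rewrite -fconnect_orbit def_b permX fconnect_iter.
have s_c: fcycle s (fingraph.orbit s (lshift m a)).
  exact: (cycle_orbit perm_inj).
have [i def_i] := orbit_rot_cycle s_c (orbit_uniq _ _) s_b.
move=> c; rewrite /trunc_cycle def_i map_rot.
set l := map _ _; rewrite -[in RHS](cat_take_drop i l) pmap_cat.
rewrite /rot pmap_cat -rot_size_cat next_rot // -pmap_cat cat_take_drop.
exact: trunc_cycle_uniq.
Qed.

Lemma trunc_cycle_id s a : a \in trunc_cycle s a.
Proof. by rewrite mem_trunc_cycle porbit_id. Qed.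

Lemma trunc_cycle_sym s a b :
  (a \in trunc_cycle s b) = (b \in trunc_cycle s a).
Proof. by rewrite !mem_trunc_cycle porbit_sym. Qed.


Definition trunc_fun (s : 'S_(n + m)) (a : 'I_n) : 'I_n :=
  next (trunc_cycle s a) a.

Fact trunc_fun_inj s : injective (trunc_fun s).
Proof.
move=> a b; rewrite /trunc_fun => eq_ab.
have s_a: next (trunc_cycle s a) a \in trunc_cycle s a.
  by rewrite mem_next trunc_cycle_id.
have s_b: next (trunc_cycle s a) a \in trunc_cycle s b.
  by rewrite eq_ab mem_next trunc_cycle_id.
have s_ba: b \in trunc_cycle s a.
  move: s_a s_b; rewrite !mem_trunc_cycle -!eq_porbit_mem => /eqP-> /eqP->.
  by [].
move: eq_ab; rewrite (trunc_cycle_next s_ba).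
exact: (can_inj (prev_next (trunc_cycle_uniq s a))).
Qed.

Definition trunc_perm (s : 'S_(n + m)) : 'S_n := perm (@trunc_fun_inj s).

Lemma porbit_trunc s a :
  porbit (trunc_perm s) a = [set b | lshift m b \in porbit s (lshift m a)].
Proof.
apply/setP=> b; rewrite inE -mem_trunc_cycle.
have tr_c: fcycle (trunc_perm s) (trunc_cycle s a).
  have := cycle_next (trunc_cycle_uniq s a).
  rewrite (@eq_in_cycle _ (mem (trunc_cycle s a)) _ (frel (trunc_perm s))) //.
    move=> c d s_c s_d /=.
    by rewrite permE /trunc_fun (trunc_cycle_next s_c).
rewrite -(fconnect_cycle tr_c (trunc_cycle_id s a)); apply/idP/idP.
  by case/porbitP=> i ->; rewrite permX fconnect_iter.
by move/iter_findex => <-; rewrite -permX mem_porbit.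
Qed.

Lemma card_porbits_trunc s : (#|porbits (trunc_perm s)| <= #|porbits s|)%N.
Proof.
pose f (B : {set 'I_(n + m)}) : {set 'I_n} := [set b | lshift m b \in B].
apply: leq_trans _ (leq_imset_card f _).
apply/subset_leq_card/subsetP=> _ /imsetP[a _ ->].
by rewrite porbit_trunc (imset_f f) // imset_f.
Qed.

(* The subtraction is never truncated, by [card_porbits_trunc]. *)
Definition Tr (p : F) (x : permalg F (n + m)) : permalg F n :=
  \sum_(s : 'S_(n + m))
    (x s * p ^+ (#|porbits s| - #|porbits (trunc_perm s)|))
      *: pbasis F (trunc_perm s).

End Trace.

Section Generators.
Variables (n : nat) (z : 'I_n -> F) (h p : F).

Definition Tfactor (m : nat) (a : 'I_n) : {poly permalg F (n + m)} :=
  'X - ((z a)%:A)%:P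
  + (h *: \sum_(i < m) pbasis F (tperm (lshift m a) (rshift n i)))%:P.

(* The factors occur in decreasing order of the index, from n to 1. *)
Definition Tpoly (m : nat) : {poly permalg F n} :=
  map_poly (Tr p)
    ((theta n (antisym m))%:P * \prod_(a < n) Tfactor m (rev_ord a)).

Definition Tcoef (m i : nat) : permalg F n := (Tpoly m)`_(n - i).

(* [agenv U] is the smallest subalgebra containing 1 and U. *)
Definition Bethe : {aspace permalg F n} :=
  agenv <<[seq Tcoef m i | m <- iota 1 n.-1, i <- iota 1 n]>>%VS.

End Generators.
End Bethe.

(* Main.v *)
Require Import Defs.
From HB Require Import structures.
From mathcomp Require Import all_boot all_order all_algebra all_fingroup all_field.
From mathcomp Require Import ring.
From mathcomp Require Import reals complex.

Set Implicit Arguments.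
Unset Strict Implicit.
Unset Printing Implicit Defensive.

Import GRing.Theory Num.Theory.

Local Open Scope ring_scope.
Local Open Scope complex_scope.

(** The generators are transfer matrices: partial traces over [m] auxiliary
   points of an antisymmetrizer times a product of factors [L_a], one for each
   point [a]. Such traces commute because an invertible intertwiner exchanges
   the two families of factors and can be carried around the trace.

   The product of a trace over [m] points and a trace over [k] points is a
   single trace over [m + k] points ([Tr_mul_Tr]); in one order the traced
   element is [A * E * \prod_a (L_a * L'_a)], in the other [A * E * \prod_a
   (L'_a * L_a)], where [A] and [E] are the antisymmetrizers of the two
   auxiliary blocks. This double trace is invariant under conjugation by
   permutations that fix the original points ([double_Tr_cyclic]), so it is
   enough to find an element [R] supported on the auxiliary points with [E * R
   * L_a * L'_a = E * L'_a * L_a * R].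

   One block is kept fused and the other is taken apart. The factor [L_a] is,
   up to a scalar and after multiplication by [A], a product of elementary
   factors [t + h * (a i)], one for each auxiliary point [i], with arguments in
   arithmetic progression ([rprod_fusion]). For one such point the exchange
   relation is a Yang-Baxter equation ([fused_yang_baxter]); it holds because
   under [E] the sum of the transpositions of a point with the points of the
   second block satisfies a quadratic equation ([antisym_star_sqr]). A train
   argument then gives the relation for the taken apart form of all [L_a] at
   once ([intertwine]), with [R] an ordered product of linear factors. The
   quadratic equation also inverts [R] up to a scalar ([R_mul_Rinv]), and since
   the arguments of its factors are in arithmetic progression, [A * R * A = A *
   R] ([rprod_skew]); hence the trace argument takes place in the corner of the
   algebra cut out by [A] ([corner_exchange], [exchange]).

   The scalars that have to be inverted are nonzero for all but finitely many
   values of one spectral parameter, the other being fixed. The commutators of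
   the transfer matrices are polynomial in both parameters, so all coefficients
   commute ([Tpoly_coef_comm]), and so does the algebra that they generate. *)

(** * Functorial maps between group algebras *)

Section GroupAlgebra.
Variables (F : fieldType) (n : nat).

Lemma permalgN (x : permalg F n) s : (- x) s = - x s.
Proof. exact: ffunE. Qed.

Lemma pbasis1 : pbasis F (1%g : 'S_n) = 1.
Proof. by []. Qed.

Lemma pbasis_mul (s t : 'S_n) : pbasis F s * pbasis F t = pbasis F (t * s)%g.
Proof. exact: pbasisM. Qed.

Lemma linear_basis_eq (V : lmodType F) (f g : {linear permalg F n -> V}) :
  (forall s, f (pbasis F s) = g (pbasis F s)) -> f =1 g.
Proof.
move=> fg x; rewrite (permalg_expand x) !linear_sum; apply: eq_bigr => s _.
by rewrite !linearZ fg.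
Qed.

End GroupAlgebra.

Section Coefficients.
Variables (F : fieldType) (n : nat) (s : 'S_n).
Implicit Types (x y : permalg F n) (a b c : F).

Lemma coefD x y a b : x s = a -> y s = b -> (x + y) s = a + b.
Proof. by rewrite permalgD => -> ->. Qed.

Lemma coefN x a : x s = a -> (- x) s = - a.
Proof. by rewrite permalgN => ->. Qed.

Lemma coefZ c x a : x s = a -> (c *: x) s = c * a.
Proof. by rewrite permalgZ => ->. Qed.

End Coefficients.

(* The equations are read off the syntax of the expression: a search by
   unification would compare unrelated sums and multiples by unfolding them. *)
Ltac coef_eq x s :=
  lazymatch x with
  | ?y + ?z =>
    let e1 := coef_eq y s in let e2 := coef_eq z s in constr:(coefD e1 e2)
  | - ?y => let e := coef_eq y s in constr:(coefN e)
  | ?c *: ?y => let e := coef_eq y s in constr:(coefZ c e)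
  | _ => constr:(erefl (x s))
  end.

(* An identity between linear combinations that holds in every module is checked
   coefficient by coefficient, in the field. *)
Ltac module_ring :=
  let s := fresh "s" in apply/ffunP => s;
  lazymatch goal with
  | |- fun_of_fin ?x _ = fun_of_fin ?y _ =>
    let e1 := coef_eq x s in let e2 := coef_eq y s in
    refine (etrans e1 (etrans _ (esym e2)))
  end; ring.

Section Extension.
Variables (m N : nat) (f : 'I_m -> 'I_N) (f_inj : injective f).

Definition ext_fun (s : 'S_m) (x : 'I_N) : 'I_N :=
  if [pick a | f a == x] is Some a then f (s a) else x.

Lemma ext_fun_in s a : ext_fun s (f a) = f (s a).
Proof.
by rewrite /ext_fun; case: pickP => [b /eqP/f_inj -> // | /(_ a)/eqP].
Qed.

Lemma ext_fun_out s x : (forall a, f a != x) -> ext_fun s x = x.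
Proof.
by rewrite /ext_fun => fx; case: pickP => [b | //]; rewrite (negPf (fx b)).
Qed.

Lemma codom_case x : {a | x = f a} + (forall a, f a != x).
Proof.
case: (pickP (fun a => f a == x)) => [a /eqP <- | no_a]; first by left; exists a.
by right=> a; rewrite no_a.
Qed.

Fact ext_fun_inj s : injective (ext_fun s).
Proof.
move=> x y; case: (codom_case x) => [[a ->]|fx]; case: (codom_case y) => [[b ->]|fy].
- by rewrite !ext_fun_in => /f_inj/perm_inj ->.
- by rewrite ext_fun_in ext_fun_out // => /eqP; rewrite (negPf (fy _)).
- by rewrite ext_fun_in ext_fun_out // => /esym/eqP; rewrite (negPf (fx _)).
by rewrite !ext_fun_out.
Qed.

Definition ext_perm (s : 'S_m) : 'S_N := perm (@ext_fun_inj s).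

Lemma ext_perm_in (s : 'S_m) a : ext_perm s (f a) = f (s a).
Proof. by rewrite permE ext_fun_in. Qed.

Lemma ext_perm_out s x : (forall a, f a != x) -> ext_perm s x = x.
Proof. by move=> fx; rewrite permE ext_fun_out. Qed.

Lemma ext_permP (s : 'S_m) (t : 'S_N) :
  (forall a, t (f a) = f (s a)) -> (forall x, (forall a, f a != x) -> t x = x) ->
  ext_perm s = t.
Proof.
move=> tf tx; apply/permP=> x; case: (codom_case x) => [[a ->]|fx].
  by rewrite ext_perm_in tf.
by rewrite ext_perm_out ?tx.
Qed.

Lemma ext_permM (s t : 'S_m) : ext_perm (s * t)%g = (ext_perm s * ext_perm t)%g.
Proof.
apply: ext_permP => [a | x fx]; rewrite !permM.
  by rewrite !ext_perm_in.
by rewrite !ext_perm_out.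
Qed.

Lemma ext_perm1 : ext_perm 1%g = 1%g.
Proof. by apply: ext_permP => *; rewrite !perm1. Qed.

Lemma ext_tperm a b : ext_perm (tperm a b) = tperm (f a) (f b).
Proof.
apply: ext_permP => [c | x fx]; last by rewrite tpermD.
case: tpermP => [->|->|/eqP ca /eqP cb]; rewrite ?tpermL ?tpermR //.
by rewrite tpermD // inj_eq // eq_sym.
Qed.

Variable F : fieldType.

Definition ext_alg (x : permalg F m) : permalg F N :=
  \sum_(s : 'S_m) x s *: pbasis F (ext_perm s).

Fact ext_alg_is_linear : linear ext_alg.
Proof.
move=> c x y; rewrite /ext_alg scaler_sumr -big_split; apply: eq_bigr => s _.
by rewrite permalgD permalgZ scalerDl scalerA.
Qed.

HB.instance Definition _ :=
  GRing.isLinear.Build F (permalg F m) (permalg F N) *:%R ext_alg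
    ext_alg_is_linear.

Lemma ext_alg_basis s : ext_alg (pbasis F s) = pbasis F (ext_perm s).
Proof.
rewrite /ext_alg (bigD1 s) //= pbasisE eqxx scale1r big1 ?addr0 // => t ts.
by rewrite pbasisE (negPf ts) scale0r.
Qed.

Lemma ext_alg_monoid : monoid_morphism ext_alg.
Proof.
split; first by rewrite -pbasis1 ext_alg_basis ext_perm1.
move=> x y; rewrite (permalg_expand x) mulr_suml !linear_sum /= mulr_suml.
apply: eq_bigr => s _; rewrite (permalg_expand y) mulr_sumr !linear_sum /= mulr_sumr.
apply: eq_bigr => t _; rewrite -scalerAl -scalerAr !linearZ /=.
by rewrite pbasis_mul !ext_alg_basis -scalerAl -scalerAr pbasis_mul ext_permM.
Qed.

HB.instance Definition _ :=
  GRing.isMonoidMorphism.Build (permalg F m) (permalg F N) ext_alg ext_alg_monoid.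

End Extension.

Arguments ext_alg {m N f} f_inj {F} x.

Lemma ext_perm_comp m n N (f : 'I_m -> 'I_n) (g : 'I_n -> 'I_N) (h : 'I_m -> 'I_N)
    (f_inj : injective f) (g_inj : injective g) (h_inj : injective h) s :
  g \o f =1 h -> ext_perm g_inj (ext_perm f_inj s) = ext_perm h_inj s.
Proof.
move=> gf; apply/esym/ext_permP => [a | x hx].
  by rewrite -!gf /= !ext_perm_in.
case: (codom_case g x) => [[b def_x]|gx]; last by rewrite ext_perm_out.
rewrite def_x ext_perm_in ext_perm_out // => a; apply: contra (hx a).
by rewrite -gf def_x => /eqP <- /=.
Qed.

Lemma ext_alg_comp (F : fieldType) m n N (f : 'I_m -> 'I_n) (g : 'I_n -> 'I_N)
    (h : 'I_m -> 'I_N) (f_inj : injective f) (g_inj : injective g)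
    (h_inj : injective h) (x : permalg F m) :
  g \o f =1 h -> ext_alg g_inj (ext_alg f_inj x) = ext_alg h_inj x.
Proof.
move=> gf; have := @linear_basis_eq F m _ (ext_alg g_inj \o ext_alg f_inj) (ext_alg h_inj).
by apply=> s /=; rewrite !ext_alg_basis (ext_perm_comp _ _ h_inj).
Qed.

Lemma theta_ext (F : fieldType) n m (x : permalg F m) :
  theta n x = ext_alg (@rshift_inj n m) x.
Proof.
apply: eq_bigr => s _; congr (_ *: pbasis F _); apply/esym/ext_permP => [a | x0 fx].
  by rewrite permE /shift_fun; case: split_ordP => b /eqP;
     rewrite ?eq_rlshift // eq_rshift => /eqP ->.
rewrite permE /shift_fun; case: split_ordP => b // def_x.
by have := fx b; rewrite def_x eqxx.
Qed.

(** * Antisymmetrizers *)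

Section Antisymmetrizer.
Variables (F : fieldType) (m N : nat) (f : 'I_m -> 'I_N) (f_inj : injective f).
Hypothesis m_neq0 : m`!%:R != 0 :> F.

Definition antisym_on : permalg F N := ext_alg f_inj (antisym F m).

Lemma antisym_onE :
  antisym_on = (m`!%:R)^-1 *: \sum_(s : 'S_m) (-1) ^+ s *: pbasis F (ext_perm f_inj s).
Proof.
rewrite /antisym_on linearZ /= (linear_sum (ext_alg f_inj)); congr (_ *: _).
by apply: eq_bigr => s _; rewrite linearZ /= ext_alg_basis.
Qed.

Lemma antisym_on_tperm i j : i != j ->
  antisym_on * pbasis F (tperm (f i) (f j)) = - antisym_on.
Proof.
move=> ij; rewrite antisym_onE -scalerAl -scalerN; congr (_ *: _).
rewrite mulr_suml -sumrN (reindex_inj (mulgI (tperm i j))) /=.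
apply: eq_bigr => s _; rewrite -scalerAl pbasis_mul -(ext_tperm f_inj).
rewrite -ext_permM mulgA tperm2 mul1g odd_permM odd_tperm ij signr_addb.
by rewrite mulN1r scaleNr.
Qed.

(** An element that changes sign under right multiplication by every
   transposition absorbs each term of the antisymmetrizer. *)
Lemma antisym_absorb (x : permalg F N) :
  (forall i j, i != j -> x * pbasis F (tperm (f i) (f j)) = - x) ->
  x * antisym_on = x.
Proof.
move=> xt; have xs s : x * pbasis F (ext_perm f_inj s) = (-1) ^+ s *: x.
  have [ts -> dts] := prod_tpermP s.
  elim: ts dts => [|t ts IH] /=.
    by rewrite big_nil ext_perm1 pbasis1 mulr1 odd_perm1 scale1r.
  case/andP=> dt dts; rewrite big_cons ext_permM -pbasis_mul mulrA IH //.
  rewrite -scalerAl ext_tperm xt // odd_permM odd_tperm dt signr_addb.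
  by rewrite mulN1r scaleNr scalerN.
rewrite antisym_onE -scalerAr mulr_sumr.
under eq_bigr => s _ do rewrite -scalerAr xs scalerA -expr2 sqrr_sign scale1r.
by rewrite sumr_const card_Sn -scaler_nat scalerA mulVf // scale1r.
Qed.

Lemma antisym_on_idem : antisym_on * antisym_on = antisym_on.
Proof. exact: antisym_absorb antisym_on_tperm. Qed.

Lemma comm_antisym_on (x : permalg F N) :
  (forall s, GRing.comm x (pbasis F (ext_perm f_inj s))) -> GRing.comm x antisym_on.
Proof.
move=> xs; rewrite antisym_onE /GRing.comm -scalerAr -scalerAl; congr (_ *: _).
by apply: commr_sum => s _; rewrite /GRing.comm -scalerAr -scalerAl xs.
Qed.

End Antisymmetrizer.

(** * Star elements *)

Section Star.
Variables (F : fieldType) (N : nat).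
Local Notation B := (permalg F N).
Implicit Types (i j l b : 'I_N) (K : seq 'I_N) (h t : F) (x y A E : B).

Definition transp i j : B := pbasis F (tperm i j).

(** When [K] consists of the points smaller than [i], this is a multiple of a
   Jucys-Murphy element. *)
Definition star h K i : B := h *: \sum_(b <- K) transp i b.

Lemma transpC i j : transp i j = transp j i.
Proof. by rewrite /transp tpermC. Qed.

Lemma transpK i j : transp i j * transp i j = 1.
Proof. by rewrite pbasis_mul tperm2. Qed.

Lemma pbasis_transp (s : 'S_N) i j :
  pbasis F s * transp i j = transp (s i) (s j) * pbasis F s.
Proof. by rewrite !pbasis_mul -tpermJ -conjgC. Qed.

Lemma pbasis_star (s : 'S_N) h K i :
  pbasis F s * star h K i = star h (map s K) (s i) * pbasis F s.
Proof.
rewrite /star -scalerAr -scalerAl mulr_sumr big_map mulr_suml; congr (_ *: _).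
by apply: eq_bigr => b _; rewrite pbasis_transp.
Qed.

Lemma eq_star h K1 K2 i : perm_eq K1 K2 -> star h K1 i = star h K2 i.
Proof. by move=> eqK; rewrite /star (perm_big K2). Qed.

Lemma star_cons h b K i : star h (b :: K) i = h *: transp i b + star h K i.
Proof. by rewrite /star big_cons scalerDr. Qed.

Lemma star1 h b i : star h [:: b] i = h *: transp i b.
Proof. by rewrite /star big_seq1. Qed.

Lemma starN h K i : star (- h) K i = - star h K i.
Proof. by rewrite /star scaleNr. Qed.

Lemma pbasis_star_comm (s : 'S_N) h K i :
  uniq K -> (forall b, b \in K -> s b \in K) -> s i = i ->
  GRing.comm (pbasis F s) (star h K i).
Proof.
move=> uK sK si; rewrite /GRing.comm pbasis_star si; congr (_ * _).
have usK: uniq (map s K) by rewrite map_inj_uniq //; apply: perm_inj.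
apply/eq_star/uniq_perm => //; have [||_ //] := @uniq_min_size _ (map s K) K usK.
  by move=> _ /mapP[b bK ->]; apply: sK.
by rewrite size_map.
Qed.

Lemma transp_star_comm i j h K l :
  uniq K -> l != i -> l != j -> (i \in K) = (j \in K) ->
  GRing.comm (transp i j) (star h K l).
Proof.
move=> uK li lj ijK; apply: pbasis_star_comm => // [b bK|]; last first.
  by rewrite tpermD // eq_sym.
by case: tpermP bK => [->|->|] //; rewrite ijK.
Qed.

Lemma transp_star i j h K : i \notin K -> j \notin K ->
  transp i j * star h K i = star h K j * transp i j.
Proof.
move=> iK jK; rewrite pbasis_star tpermL; congr (star h _ _ * _).
rewrite -[RHS]map_id; apply/eq_in_map => b bK.
by rewrite tpermD //; [apply: contraNneq iK | apply: contraNneq jK] => ->.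
Qed.

Lemma star1_star i j h c K : i \notin K -> j \notin K ->
  star c [:: j] i * star h K i = star h K j * star c [:: j] i.
Proof.
by move=> iK jK; rewrite star1 -[LHS]scalerAl -[RHS]scalerAr transp_star.
Qed.

Lemma comm_starr x h K i :
  (forall b, b \in K -> GRing.comm x (transp i b)) -> GRing.comm x (star h K i).
Proof.
move=> xK; rewrite /GRing.comm /star -scalerAr -scalerAl; congr (_ *: _).
by rewrite mulr_sumr mulr_suml; apply: eq_big_seq => b /xK.
Qed.

Lemma star_comm h1 h2 K1 K2 i1 i2 :
  uniq K2 -> i1 != i2 -> i1 \notin K2 -> i2 \notin K1 ->
  {in K1, forall b, b \notin K2} ->
  GRing.comm (star h1 K1 i1) (star h2 K2 i2).
Proof.
move=> uK2 i12 i1K i2K K12; apply/commr_sym/comm_starr => b bK1.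
apply/commr_sym/transp_star_comm => //; first by rewrite eq_sym.
  by apply: contraNneq i2K => ->.
by rewrite (negPf i1K); apply/esym/negbTE/K12.
Qed.

(** The transposition of [j] and a point of [K] permutes the set formed by
   [j] and [K], which is the leaf set of the star on the left. *)
Lemma star_adjoin_comm h K i j : uniq K -> i != j -> i \notin K -> j \notin K ->
  GRing.comm (h *: transp i j + star h K i) (star h K j).
Proof.
move=> uK ij iK jK; rewrite -star_cons; apply: comm_starr => b bK.
apply/commr_sym/transp_star_comm => //; first by rewrite /= jK.
  by apply: contraNneq iK => ->.
by rewrite !inE eqxx bK orbT.
Qed.

Lemma transp_braid i b c : i != b -> i != c -> b != c ->
  transp i b * transp i c = transp b c * transp i b.
Proof.
by move=> ib ic bc; rewrite pbasis_transp tpermL tpermD.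
Qed.

(** On the exterior power of the leaves, a star satisfies a quadratic
   equation: two steps of the star either cancel or, by the braid relation,
   reduce to one step at the cost of a sign. *)
Lemma antisym_star_sqr E h K i : uniq K -> i \notin K ->
  {in K &, forall b c, b != c -> E * transp b c = - E} ->
  E * star h K i * star h K i =
    (h ^+ 2 * (size K)%:R) *: E - (h * ((size K)%:R - 1)) *: (E * star h K i).
Proof.
move=> uK iK Esg.
have term c : c \in K -> E * (\sum_(b <- K) transp i b) * transp i c =
    E - (E * (\sum_(b <- K) transp i b) - E * transp i c).
  move=> cK; rewrite (big_rem c) //= mulrDr mulrDl -mulrA transpK mulr1.
  congr (_ + _); rewrite addrC addKr mulr_sumr mulr_suml -sumrN.
  apply: eq_big_seq => b; rewrite mem_rem_uniq // => /andP[bc bK].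
  have neq (d : 'I_N) : d \in K -> i != d by apply: contraTneq => <-.
  by rewrite -mulrA transp_braid ?neq // mulrA Esg // mulNr.
rewrite /star -!scalerAr -!scalerAl [_ * \sum_(_ <- _) _]mulr_sumr.
rewrite (eq_big_seq _ term) !sumrB -[\sum_(j <- K) E * transp i j]mulr_sumr.
set ES := E * _; rewrite !big_const_seq !count_predT !iter_addr_0 -!scaler_nat.
by module_ring.
Qed.

(** * Products of R-matrices *)

(** A row of R-matrices, one for each point of [s]. The arithmetic progression of
   the arguments makes the row compatible with antisymmetrization over [s]. *)
Fixpoint rprod (q : 'I_N -> B) h t (s : seq 'I_N) : B :=
  if s is i :: s' then (t%:A + q i) * rprod q h (t + h) s' else 1.

Lemma rprod_cat q h t s1 s2 :
  rprod q h t (s1 ++ s2) = rprod q h t s1 * rprod q h (t + (size s1)%:R * h) s2.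
Proof.
elim: s1 t => [|i s1 IH] t /=; first by rewrite mul1r mul0r addr0.
by rewrite IH mulrA; congr (_ * rprod _ _ _ _); rewrite -addn1 natrD; ring.
Qed.

Lemma rprod_rcons q h t s i :
  rprod q h t (rcons s i) = rprod q h t s * ((t + (size s)%:R * h)%:A + q i).
Proof. by rewrite -cats1 rprod_cat /= mulr1. Qed.

Lemma comm_shift x t y : GRing.comm x y -> GRing.comm x (t%:A + y).
Proof. by move=> xy; apply: commrD => //; apply/commr_sym/comm_alg. Qed.

Lemma comm_rprod x q h t s :
  (forall i, i \in s -> GRing.comm x (q i)) -> GRing.comm x (rprod q h t s).
Proof.
elim: s t => [|i s IH] t xq /=; first exact: commr1.
apply: commrM; first by apply/comm_shift/xq/mem_head.
by apply: IH => j js; apply: xq; rewrite in_cons js orbT.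
Qed.

Lemma mulr_shift y t x : y * (t%:A + x) = t *: y + y * x.
Proof. by rewrite mulrDr mulr_algr. Qed.

(** Here [p] and [q] are the stars at two points and [sg] is the transposition of
   these points. Since the arguments differ by [h], the product of the two
   factors differs from its conjugate by [sg] by [h (p - q) (1 - sg)], and
   [y (p - q)] is invariant under right multiplication by [sg]. *)
Lemma skew_two_factors y p q sg h t :
  p * sg = sg * q -> q * sg = sg * p -> GRing.comm (h *: sg + p) q -> y * sg = - y ->
  y * (t%:A + p) * ((t + h)%:A + q) * sg = - (y * (t%:A + p) * ((t + h)%:A + q)).
Proof.
move=> sgp sgq adj ysg.
have ypq : y * p * q = y * q * p + h *: (y * q - y * p).
  have : y * ((h *: sg + p) * q) = y * (q * (h *: sg + p)).
    by congr (y * _); apply: adj.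
  rewrite !(mulrDl, mulrDr) -!scalerAl -!scalerAr sgq !mulrA ysg !mulNr !scalerN.
  by move/(canRL (addKr _)) => ->; module_ring.
have e1 : y * p * sg = - (y * q) by rewrite -mulrA sgp mulrA ysg mulNr.
have e2 : y * q * sg = - (y * p) by rewrite -mulrA sgq mulrA ysg mulNr.
have e3 : y * p * q * sg = - (y * q * p) by rewrite -mulrA sgq mulrA e1 mulNr.
rewrite !mulr_shift !mulrDl -!scalerAl !mulrDl -!scalerAl ysg e1 e2 e3 ypq.
by module_ring.
Qed.

(** Skew symmetry in a pair of points is a transitive relation, so it suffices to
   treat consecutive points of [s]. The transposition of two such points commutes
   with all factors but two, and these are covered by [skew_two_factors]. *)
Lemma rprod_skew A h K t s : uniq K -> uniq s -> {in s, forall i, i \notin K} ->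
  {in s &, forall i j, i != j -> A * transp i j = - A} ->
  {in s &, forall i j, i != j ->
    A * rprod (star h K) h t s * transp i j = - (A * rprod (star h K) h t s)}.
Proof.
move=> uK us sK skA; set y := A * _.
pose e i j := (i == j) || (y * transp i j == - y).
have e_sym : symmetric e by move=> i j; rewrite /e eq_sym transpC.
have e_tr : transitive e.
  move=> j i l; rewrite /e; have [-> //|ij /= /eqP yij] := eqVneq i j.
  have [<- |jl /= /eqP yjl] := eqVneq j l; first by rewrite yij eqxx orbT.
  have [//|il /=] := eqVneq i l.
  (* conjugating the transposition of [j] and [l] by that of [i] and [j] *)
  have -> : transp i l = transp i j * transp j l * transp i j.
    by rewrite pbasis_transp tpermR tpermD // -mulrA transpK mulr1.
  by rewrite !mulrA yij mulNr yjl opprK yij.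
have e_sorted : sorted e s.
  case: s us sK skA @y @e e_sym e_tr => // i0 s0; set s := i0 :: s0.
  move=> us sK skA y e _ _; apply/(sortedP i0) => l lt_l.
  have ll : (l < size s)%N := ltnW lt_l.
  set i := nth i0 s l; set j := nth i0 s l.+1.
  have def_s : s = take l s ++ [:: i, j & drop l.+2 s].
    by rewrite -!drop_nth // cat_take_drop.
  have iS : i \in s := mem_nth _ ll; have jS : j \in s := mem_nth _ lt_l.
  have ij : i != j by rewrite nth_uniq // neq_ltn leqnn.
  have comm_part r u : {subset r <= s} -> i \notin r -> j \notin r ->
      GRing.comm (transp i j) (rprod (star h K) h u r).
    move=> rs ir jr; apply: comm_rprod => b br; apply: transp_star_comm => //.
    - by apply: contraNneq ir => <-.
    - by apply: contraNneq jr => <-.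
    by rewrite (negPf (sK _ iS)) (negPf (sK _ jS)).
  have [il jl ir jr] : [/\ i \notin take l s, j \notin take l s,
      i \notin drop l.+2 s & j \notin drop l.+2 s].
    have := us; rewrite {1}def_s cat_uniq /= !inE !negb_or.
    by case/and3P=> _ /and3P[il jl _] /and3P[/andP[_ ir] jr _]; split.
  have sub_l : {subset take l s <= s} by move=> b; apply: mem_take.
  have sub_r : {subset drop l.+2 s <= s} by move=> b; apply: mem_drop.
  rewrite /e (negPf ij) /= /y def_s rprod_cat /= !mulrA.
  set r1 := rprod _ _ t _; set r2 := rprod _ _ _ (drop _ _).
  rewrite -mulrA -[r2 * _](comm_part _ _ sub_r ir jr) !mulrA.
  rewrite (@skew_two_factors (A * r1)) ?mulNr //.
  - by rewrite transpC transp_star ?sK.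
  - by rewrite transp_star ?sK.
  - by apply: star_adjoin_comm; rewrite ?sK.
  by rewrite -mulrA -(comm_part _ _ sub_l il jl) mulrA skA ?mulNr.
have s_e i j : i \in s -> j \in s -> e i j.
  case: s us sK skA @y @e e_sym e_tr e_sorted => // i0 s0 _ _ _ y e e_sym e_tr.
  move=> /(order_path_min e_tr)/allP e0.
  have {}e0 b : b \in i0 :: s0 -> e i0 b.
    by rewrite inE => /predU1P[->|/e0//]; rewrite /e eqxx.
  move=> si sj; have := e0 i si; rewrite e_sym => ei; exact: e_tr ei (e0 j sj).
by move=> i j si sj ij; have := s_e i j si sj; rewrite /e (negPf ij) => /eqP.
Qed.

(** Fusion. When a factor is appended, the products of two transpositions
   collapse to single transpositions by the braid relation and skew symmetry, and
   the shift by [h] makes the result a multiple of the longer star. *)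
Lemma rprod_fusion A h a t i s : uniq (i :: s) -> a \notin i :: s ->
  {in i :: s &, forall b c, b != c -> A * transp b c = - A} ->
  A * rprod (star h [:: a]) h t (i :: s) =
    (\prod_(j < size s) (t + j%:R * h)) *:
      (A * ((t + (size s)%:R * h)%:A + star h (i :: s) a)).
Proof.
elim/last_ind: s => [|s b IH] us as_ skA.
  by rewrite big_ord0 scale1r /= mulr1 mul0r addr0 !star1 transpC.
have sub : {subset i :: s <= i :: rcons s b}.
  by move=> c; rewrite -rcons_cons mem_rcons [c \in b :: _]inE orbC => ->.
have := us; have := as_; rewrite -rcons_cons mem_rcons rcons_uniq => as' /andP[bs us'].
have {as'}[ab as'] : a != b /\ a \notin i :: s by apply/andP; rewrite -negb_or.
rewrite rprod_rcons mulrA IH //; last first.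
  by move=> c d /sub cs /sub ds; apply: skA.
rewrite size_rcons big_ord_recr /= -scalerAl -scalerA; congr (_ *: _).
have -> : star h (rcons (i :: s) b) a = star h [:: a] b + star h (i :: s) a.
  by rewrite (eq_star _ _ (permEl (perm_rcons _ _))) [LHS]star_cons star1 transpC.
(* the braid relation replaces each cross term by a skew one *)
have Sb : A * star h (i :: s) a * star h [:: a] b = - (h *: (A * star h (i :: s) a)).
  rewrite star1 /star -!scalerAr -!scalerAl -!scalerN; congr (_ *: (_ *: _)).
  rewrite mulr_sumr mulr_suml -sumrN; apply: eq_big_seq => c cs.
  have cb : c != b by apply: contraNneq bs => <-.
  have ac : a != c by apply: contraNneq as' => ->.
  have bS : b \in i :: rcons s b by rewrite -rcons_cons mem_rcons mem_head.
  rewrite [transp b a]transpC -mulrA transp_braid // mulrA.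
  by rewrite (skA c b (sub c cs) bS cb) mulNr.
move: (star h (i :: s) a) (star h [:: a] b) Sb => S q Sb.
rewrite !mulr_shift mulrDr mulrDl -scalerAl Sb -addn1 natrD.
by module_ring.
Qed.

End Star.

(** * The intertwiner *)

Section RingLemmas.
Variables (F : fieldType) (B : algType F).
Implicit Types (a c : F).

Lemma quadratic_comm (E M Q : B) a c : GRing.comm E M ->
  E * Q * Q = a *: E - c *: (E * Q) ->
  E * M * Q * Q = a *: (E * M) - c *: (E * M * Q).
Proof.
by move=> EM EQ; rewrite EM -(mulrA M) -(mulrA M) EQ mulrBr -!scalerAr.
Qed.

(** One exchange step moves the next pair of factors through the remaining
   ones by far commutativity. *)
Lemma intertwine_step (E P M Q R X : B) :
  GRing.comm R M -> GRing.comm P X -> GRing.comm E P -> GRing.comm E M ->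
  E * (P * M * Q) = E * (Q * M * P) -> E * (R * X * Q) = E * (Q * X * R) ->
  E * (P * R * (M * X) * Q) = E * (Q * (M * X) * (P * R)).
Proof.
move=> RM PX EP EM yb IH.
transitivity (P * M * (E * (R * X * Q))).
  by rewrite !mulrA -(mulrA P M) -EM mulrA -EP -(mulrA _ R M) RM !mulrA.
rewrite IH; transitivity (E * (P * M * Q) * X * R).
  by rewrite !mulrA -(mulrA P M) -EM mulrA -EP.
by rewrite yb !mulrA -(mulrA _ P X) PX !mulrA.
Qed.

End RingLemmas.

Section Intertwiner.
Variables (F : fieldType) (N : nat).
Local Notation B := (permalg F N).
Implicit Types (i j l b : 'I_N) (s : seq 'I_N) (h t y w c : F).

Lemma comm_shiftl (x y : B) t : GRing.comm x y -> GRing.comm (t%:A + x) y.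
Proof. by move=> xy; apply/commr_sym/comm_shift/commr_sym. Qed.

(** The Yang-Baxter equation for one free auxiliary point [i], one fused
   auxiliary block and one further point [a]: [M] is the transposition of [a]
   and [i], while [P] and [Q] are the stars at [i] and at [a] with leaves in
   the block. By the quadratic relation satisfied by [P] and [Q] under [E], the
   difference of the two sides is a scalar multiple of [E * M * (Q - P)]; the
   shift [c] makes this scalar vanish. *)
Lemma fused_yang_baxter (E M P Q : B) a c x y :
  P * M = M * Q -> Q * M = M * P -> GRing.comm (M + P) Q -> GRing.comm E M ->
  E * P * P = a *: E - c *: (E * P) -> E * Q * Q = a *: E - c *: (E * Q) ->
  E * (((x - y + c)%:A + P) * (x%:A + M) * (y%:A + Q)) =
  E * ((y%:A + Q) * (x%:A + M) * ((x - y + c)%:A + P)).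
Proof.
move=> PM QM MPQ EM EP EQ.
have EPM : E * P * M = E * M * Q by rewrite -mulrA PM mulrA.
have EQM : E * Q * M = E * M * P by rewrite -mulrA QM mulrA.
have EPMQ := quadratic_comm EM EQ; have EQMP := quadratic_comm EM EP.
have EPQ : E * P * Q = E * M * P + E * Q * P - E * M * Q.
  have := congr1 (fun u => E * u) MPQ; rewrite /= mulrDl !mulrDr !mulrA EQM.
  by move/(canRL (addKr _)) => ->; rewrite addrC.
rewrite !mulrA !mulr_shift !mulrDl -!scalerAl !mulrDl -!scalerAl.
rewrite EPM EQM EPMQ EQMP EPQ.
move: (E * M * P) (E * Q * P) (E * M * Q) (E * M) (E * P) (E * Q).
move=> EMP EQP EMQ EM' EP' EQ'.
by module_ring.
Qed.

(* [E] stands for the antisymmetrizer over the points of [K]. *)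
Variables (K : seq 'I_N) (E : B) (h : F).
Hypothesis uK : uniq K.
Hypothesis skewE : {in K &, forall b b', b != b' -> E * transp F b b' = - E}.
Hypothesis commE_star : forall h i, i \notin K -> GRing.comm E (star h K i).
Hypothesis commE_transp :
  forall i j, i \notin K -> j \notin K -> GRing.comm E (transp F i j).

Let commE_star1 i j : i \notin K -> j \notin K -> GRing.comm E (star h [:: j] i).
Proof.
by move=> iK jK; apply: comm_starr => b; rewrite inE => /eqP ->; apply: commE_transp.
Qed.

Let k : F := (size K)%:R.
Let Rmx w s := rprod (star h K) h w s.
Let Xmx a t s := rprod (star h [:: a]) h t s.

Lemma intertwine_point s a t y : uniq s -> a \notin s -> a \notin K ->
    {in s, forall i, i \notin K} ->
  E * (Rmx (t - y + h * (k - 1)) s * Xmx a t s * (y%:A + star h K a)) =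
  E * ((y%:A + star h K a) * Xmx a t s * Rmx (t - y + h * (k - 1)) s).
Proof.
rewrite /Rmx /Xmx; move=> + + aK; elim: s t => [|i s IH] t us as_ sK /=.
  by rewrite !mulr1 mul1r.
have iK : i \notin K by apply: sK; rewrite mem_head.
have {}sK : {in s, forall i, i \notin K} by move=> j js; apply: sK; rewrite inE js orbT.
case/andP: us => is_ us; rewrite inE negb_or in as_; case/andP: as_ => ai as_.
have {}IH := IH (t + h) us as_ sK.
have def_w : t + h - y + h * (k - 1) = t - y + h * (k - 1) + h by ring.
rewrite def_w in IH; set w := t - y + h * (k - 1) in IH *.
set R := rprod (star h K) _ _ _ in IH *; set X := rprod (star h [:: a]) _ _ _ in IH *.
set P := star h K i; set M := star h [:: a] i; set Q := star h K a in IH *.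
have RM : GRing.comm R (t%:A + M).
  apply/comm_shift/commr_sym/comm_rprod => j js; apply: star_comm => //.
  - by apply: contraNneq is_ => ->.
  - by rewrite inE eq_sym; apply: contraNneq as_ => ->.
  by move=> b; rewrite inE => /eqP ->.
have PX : GRing.comm (w%:A + P) X.
  apply/comm_rprod => j js; apply/comm_shiftl/star_comm => //.
  - by apply: contraNneq is_ => ->.
  - by rewrite inE eq_sym.
  - exact: sK.
  by move=> b bK; rewrite inE; apply: contraNneq aK => <-.
have Ew : GRing.comm E (w%:A + P) by apply/comm_shift/commE_star.
have Et : GRing.comm E (t%:A + M) by apply/comm_shift/commE_star1.
have yb : E * ((w%:A + P) * (t%:A + M) * (y%:A + Q)) =
          E * ((y%:A + Q) * (t%:A + M) * (w%:A + P)).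
  have sqr j : j \notin K -> E * star h K j * star h K j =
      (h ^+ 2 * k) *: E - (h * (k - 1)) *: (E * star h K j).
    by move=> jK; apply: antisym_star_sqr.
  apply: fused_yang_baxter (sqr i iK) (sqr a aK).
  - have -> : M = star h [:: i] a by rewrite /M !star1 transpC.
    exact/esym/star1_star.
  - exact/esym/star1_star.
  - by rewrite /M star1; apply: star_adjoin_comm; rewrite // eq_sym.
  exact: commE_star1.
exact: intertwine_step RM PX Ew Et yb IH.
Qed.

(** The arguments of the two families of factors may depend on the point, but
   their difference may not: the same R-matrix then serves for all points. *)
Lemma intertwine (T : eqType) (pt : T -> 'I_N) s (Z : seq T) (t y : T -> F) w :
    uniq s -> {in s, forall i, i \notin K} ->
    {in Z, forall a,
      [/\ pt a \notin s, pt a \notin K & t a - y a + h * (k - 1) = w]} ->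
  let X a := Xmx (pt a) (t a) s in let Y a := (y a)%:A + star h K (pt a) in
  E * (Rmx w s * \prod_(a <- Z) (X a * Y a)) =
  E * ((\prod_(a <- Z) (Y a * X a)) * Rmx w s).
Proof.
move=> us sK + X Y; elim: Z => [|a Z IH] aZ; first by rewrite !big_nil mul1r mulr1.
have [as_ aK def_w] := aZ a (mem_head _ _).
have {}IH := IH (fun d dZ => aZ d (@mem_behead _ (a :: Z) d dZ)).
have eq_a : E * (Rmx w s * X a * Y a) = E * (Y a * X a * Rmx w s).
  by rewrite -def_w; apply: intertwine_point.
have EYX : E * Y a * X a = Y a * X a * E.
  rewrite -mulrA; apply: commrM; first by apply/comm_shift/commE_star.
  by apply: comm_rprod => i /sK iK; apply: commE_star1.
rewrite !big_cons.
transitivity (E * (Rmx w s * X a * Y a) * \prod_(a <- Z) (X a * Y a)).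
  by rewrite !mulrA.
rewrite eq_a; transitivity (Y a * X a * (E * (Rmx w s * \prod_(a <- Z) (X a * Y a)))).
  by rewrite !mulrA EYX.
by rewrite IH !mulrA EYX.
Qed.

(** By the quadratic equation of [star h K i] under [E], the factor with argument
   [w] is inverted, up to a scalar, by a factor with the opposite star and argument
   [w - h * (k - 1)]. *)
Definition Rinv w s := rprod (star (- h) K) (- h) (w + (size s)%:R * h - h * k) (rev s).

Definition Rscalar w r := \prod_(j < r) ((w + j%:R * h - h * k) * (w + j%:R * h + h)).

Let RinvE i s w :
  Rinv w (i :: s) = Rinv (w + h) s * ((w - h * (k - 1))%:A - star h K i).
Proof.
rewrite /Rinv rev_cons rprod_rcons size_rev starN /= -addn1 natrD.
by congr (rprod _ _ _ _ * (_%:A - _)); ring.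
Qed.

Let RscalarE r w :
  Rscalar w r.+1 = (w - h * k) * (w + h) * Rscalar (w + h) r.
Proof.
rewrite /Rscalar big_ord_recl /= mul0r addr0; congr (_ * _).
by apply: eq_bigr => j _; rewrite /bump /= natrD; ring.
Qed.

Lemma R_mul_Rinv s w : {in s, forall i, i \notin K} ->
  E * (Rmx w s * Rinv w s) = Rscalar w (size s) *: E /\
  E * (Rinv w s * Rmx w s) = Rscalar w (size s) *: E.
Proof.
elim: s w => [|i s IH] w sK /=.
  by rewrite /Rmx /Rinv /= /Rscalar big_ord0 !mulr1 scale1r.
have iK : i \notin K by apply: sK; rewrite mem_head.
have {}sK : {in s, forall i, i \notin K} by move=> j js; apply: sK; rewrite inE js orbT.
have [IH1 IH2] := IH (w + h) sK.
rewrite RinvE RscalarE /Rmx /= -/(Rmx (w + h) s).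
set R := Rmx _ _ in IH1 IH2 *; set R' := Rinv _ _ in IH1 IH2 *.
have ER' : GRing.comm E R'.
  by apply: comm_rprod => j; rewrite mem_rev => /sK; apply: commE_star.
set w' := w - h * (k - 1).
have sqr := antisym_star_sqr h uK iK skewE.
move: (star h K i) (commE_star h iK) sqr => P EP sqr.
have Ew : GRing.comm E (w%:A + P) by apply: comm_shift.
have PR : E * ((w%:A + P) * (w'%:A - P)) = ((w - h * k) * (w + h)) *: E.
  rewrite mulrA !mulr_shift mulrDl mulrN -scalerAl mulrN sqr -/k /w'.
  by module_ring.
have RP : E * ((w'%:A - P) * (w%:A + P)) = ((w - h * k) * (w + h)) *: E.
  rewrite -PR; congr (_ * _); rewrite !mulrDl !mulrDr !mulr_algl !mulr_algr.
  by rewrite !mulNr !mulrN !scalerN !scalerA [w' * w]mulrC; module_ring.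
split.
  transitivity ((w%:A + P) * (E * (R * R')) * (w'%:A - P)); first by rewrite !mulrA Ew.
  by rewrite IH1 -scalerAr -Ew -scalerAl -(mulrA E) PR scalerA mulrC.
transitivity (R' * (E * ((w'%:A - P) * (w%:A + P))) * R); first by rewrite !mulrA ER'.
by rewrite RP -scalerAr -ER' -scalerAl -(mulrA E) IH2 scalerA.
Qed.

End Intertwiner.

(** * Exchange under a trace *)

Definition cyclic_for (F : fieldType) (B : algType F) (V : lmodType F)
  (phi : {linear B -> V}) (z : B) := forall x, phi (z * x) = phi (x * z).

Section Cyclic.
Variables (F : fieldType) (B : algType F) (V : lmodType F) (phi : {linear B -> V}).
Local Notation cyc := (cyclic_for phi).

Lemma cyclic1 : cyc 1.
Proof. by move=> x; rewrite mul1r mulr1. Qed.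

Lemma cyclicM a b : cyc a -> cyc b -> cyc (a * b).
Proof. by move=> ca cb x; rewrite -mulrA ca -mulrA cb mulrA. Qed.

Lemma cyclicD a b : cyc a -> cyc b -> cyc (a + b).
Proof. by move=> ca cb x; rewrite mulrDl mulrDr !linearD ca cb. Qed.

Lemma cyclicZ c a : cyc a -> cyc (c *: a).
Proof. by move=> ca x; rewrite -scalerAl -scalerAr !linearZ ca. Qed.

Lemma cyclic0 : cyc 0.
Proof. by move=> x; rewrite mul0r mulr0. Qed.

Lemma cyclic_sum (I : eqType) (r : seq I) (f : I -> B) :
  {in r, forall i, cyc (f i)} -> cyc (\sum_(i <- r) f i).
Proof.
move=> cf; rewrite big_seq.
by elim/big_ind: _ => // [|a b]; [apply: cyclic0 | apply: cyclicD].
Qed.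

(** In the corner cut out by the idempotent [A], and under [E], the element [R] is
   invertible up to [d] and conjugates [W] into [V']; a trace does not see the
   conjugation. *)
Lemma corner_exchange (A E R R' W V' : B) d :
  A * A = A -> A * R * A = A * R -> A * R' * A = A * R' -> A * V' * A = A * V' ->
  GRing.comm E A -> GRing.comm E R -> GRing.comm E R' -> GRing.comm E V' ->
  E * (R * R') = d *: E -> E * (R' * R) = d *: E -> E * (R * W) = E * (V' * R) ->
  cyc A -> cyc E -> cyc R ->
  d *: phi (A * E * W) = d *: phi (A * E * V').
Proof.
move=> AA AR AR' AV EA ER ER' EV RR' R'R RW cA cE cR.
have corner : A * R' * A * V' * (A * R * A) = A * R' * V' * R.
  rewrite AR; transitivity (A * R' * (A * V' * A) * R); first by rewrite !mulrA.
  by rewrite AV mulrA AR'.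
have -> : d *: phi (A * E * W) = phi (A * R' * A * V' * (A * R * A * E)).
  rewrite -linearZ; congr (phi _); rewrite [RHS]mulrA corner.
  transitivity (A * (E * (R' * R)) * W); first by rewrite R'R -scalerAr -!scalerAl.
  transitivity (A * R' * (E * (R * W))); first by rewrite !mulrA -(mulrA A E R') ER' !mulrA.
  by rewrite RW !mulrA -(mulrA _ E V') EV mulrA -(mulrA _ E R) ER !mulrA.
rewrite -cyclicM //; last by do !apply: cyclicM.
rewrite -linearZ; congr (phi _).
transitivity (A * R * A * E * R' * A * V').
  rewrite !mulrA -(mulrA _ E A) EA !mulrA.
  by rewrite -!(mulrA _ A A) !AA.
transitivity (A * (E * (R * R')) * A * V').
  by rewrite AR -(mulrA _ R E) -ER !mulrA.
by rewrite RR' -scalerAr -!scalerAl -(mulrA A E A) EA mulrA AA.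
Qed.

Lemma regroup_exchange (A E X Y : B) :
  GRing.comm E A -> GRing.comm E X -> GRing.comm A Y ->
  phi (A * E * (X * Y)) = phi (A * E * (Y * X)) ->
  phi (A * X * (E * Y)) = phi (E * Y * (A * X)).
Proof.
move=> EA EX AY eq_phi; transitivity (phi (A * E * (X * Y))).
  by rewrite !mulrA -(mulrA A E) EX !mulrA.
by rewrite eq_phi -EA; congr (phi _); rewrite !mulrA -(mulrA E A) AY !mulrA.
Qed.

End Cyclic.

Section Factors.
Variables (F : fieldType) (N : nat).
Local Notation B := (permalg F N).

Lemma codom_uniq (q : nat) (u : 'I_q -> 'I_N) : injective u -> uniq (codom u).
Proof. by move=> u_inj; rewrite map_inj_uniq ?enum_uniq. Qed.

Lemma antisym_on_skew (q : nat) (u : 'I_q -> 'I_N) (u_inj : injective u) :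
  {in codom u &, forall b c, b != c ->
    antisym_on F u_inj * transp F b c = - antisym_on F u_inj}.
Proof.
move=> _ _ /codomP[i ->] /codomP[j ->] ij; apply: antisym_on_tperm.
by apply: contraNneq ij => ->.
Qed.

Lemma antisym_on_star_comm (q : nat) (u : 'I_q -> 'I_N) (u_inj : injective u) h K i :
  uniq K -> i \notin codom u ->
  (forall s b, b \in K -> ext_perm u_inj s b \in K) ->
  GRing.comm (antisym_on F u_inj) (star h K i).
Proof.
move=> uK iu sK; apply/commr_sym/comm_antisym_on => s; apply/commr_sym.
apply: pbasis_star_comm => // [b|]; first exact: sK.
by apply: ext_perm_out => a; apply: contraNneq iu => <-; apply: codom_f.
Qed.

Lemma ext_perm_codom (q : nat) (u : 'I_q -> 'I_N) (u_inj : injective u) s b :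
  b \in codom u -> ext_perm u_inj s b \in codom u.
Proof. by case/codomP=> a ->; rewrite ext_perm_in codom_f. Qed.

Lemma ext_perm_disjoint (q : nat) (u : 'I_q -> 'I_N) (u_inj : injective u) s b :
  b \notin codom u -> ext_perm u_inj s b = b.
Proof.
by move=> bu; apply: ext_perm_out => a; apply: contraNneq bu => <-; apply: codom_f.
Qed.

Lemma prod_merge (T : eqType) (G H : T -> B) (r : seq T) : uniq r ->
  {in r &, forall a b, a != b -> GRing.comm (G a) (H b)} ->
  (\prod_(a <- r) G a) * (\prod_(a <- r) H a) = \prod_(a <- r) (G a * H a).
Proof.
elim: r => [|a r IH]; first by rewrite !big_nil mulr1.
move=> /= /andP[ar ur] GH; rewrite !big_cons -IH //; last first.
  by move=> b c br cr; apply: GH; rewrite inE ?br ?cr orbT.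
have aG : GRing.comm (H a) (\prod_(b <- r) G b).
  rewrite big_seq; apply: commr_prod => b br; apply/commr_sym/GH.
  - by rewrite inE br orbT.
  - exact: mem_head.
  by apply: contraNneq ar => <-.
by rewrite !mulrA -(mulrA (G a) (H a)) aG !mulrA.
Qed.

Lemma corner_prod (T : eqType) (P : B) (G : T -> B) (r : seq T) : P * P = P ->
  {in r, forall a, P * G a * P = P * G a} ->
  P * (\prod_(a <- r) G a) * P = P * \prod_(a <- r) G a.
Proof.
move=> PP; elim: r => [|a r IH] Ga; first by rewrite big_nil mulr1.
have {}IH := IH (fun b br => Ga b (@mem_behead _ (a :: r) b br)).
rewrite !big_cons !mulrA -(Ga a (mem_head _ _)).
by rewrite -(mulrA (P * G a) P) -(mulrA (P * G a)) IH.
Qed.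

Lemma fuse_prod (T : eqType) (P : B) (c : T -> F) (G H : T -> B) (r : seq T) :
  {in r, forall a, P * G a = c a *: (P * H a)} ->
  {in r, forall a, GRing.comm P (H a)} ->
  P * \prod_(a <- r) G a = (\prod_(a <- r) c a) *: (P * \prod_(a <- r) H a).
Proof.
elim: r => [|a r IH] Ga Ha; first by rewrite !big_nil scale1r.
have {}IH := IH (fun b br => Ga b (@mem_behead _ (a :: r) b br))
  (fun b br => Ha b (@mem_behead _ (a :: r) b br)).
rewrite !big_cons !mulrA Ga ?mem_head // Ha ?mem_head // -scalerAl -!(mulrA (H a)) IH.
by rewrite -scalerAr scalerA.
Qed.

End Factors.

Section Exchange.
Variables (F : fieldType) (N m k : nat) (f : 'I_m.+1 -> 'I_N) (g : 'I_k -> 'I_N).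
Hypotheses (f_inj : injective f) (g_inj : injective g).
Hypothesis fg : forall i j, f i != g j.
Hypothesis m_neq0 : m.+1`!%:R != 0 :> F.
Local Notation B := (permalg F N).
Let I := codom f.
Let J := codom g.
Let A : B := antisym_on F f_inj.
Let E : B := antisym_on F g_inj.
Variables (T : eqType) (pt : T -> 'I_N) (Z : seq T).
Variables (V : lmodType F) (phi : {linear B -> V}) (h w : F) (x y : T -> F).
Hypotheses (pt_inj : injective pt) (uZ : uniq Z).
Hypothesis Zfg : {in Z, forall a, pt a \notin I /\ pt a \notin J}.
Hypothesis phi_cyclic : forall s : 'S_N, {in Z, forall a, s (pt a) = pt a} ->
  cyclic_for phi (pbasis F s).
Hypothesis xy : {in Z, forall a, x a - y a = w}.

Let L a : B := (x a)%:A + star h I (pt a).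
Let L' a : B := (y a)%:A + star h J (pt a).

(** Two families of factors may be exchanged under a trace. The first scalar that
   has to be nonzero comes from the fusion of the factors [L], the second from the
   inversion of the R-matrix. *)
Theorem exchange :
  \prod_(a <- Z) \prod_(j < m) (x a - m%:R * h + j%:R * h) != 0 ->
  Rscalar J h (w - m%:R * h + h * (k%:R - 1)) m.+1 != 0 ->
  phi ((A * \prod_(a <- Z) L a) * (E * \prod_(a <- Z) L' a)) =
  phi ((E * \prod_(a <- Z) L' a) * (A * \prod_(a <- Z) L a)).
Proof.
set w' := w - _ + _ => kappa_neq0 d_neq0.
have [uI uJ] : uniq I /\ uniq J by split; apply: codom_uniq.
have IJ : {in I, forall i, i \notin J}.
  by move=> _ /codomP[i ->]; apply/negP=> /codomP[j /eqP]; rewrite (negPf (fg i j)).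
have JI : {in J, forall j, j \notin I}.
  by move=> j jJ; apply: contraL jJ => /IJ.
have skewA := antisym_on_skew F f_inj; have skewE := antisym_on_skew F g_inj.
have AA : A * A = A by apply: antisym_on_idem.
have E_star c i : i \notin J -> GRing.comm E (star c J i).
  by move=> iJ; apply: antisym_on_star_comm => // s b; apply: ext_perm_codom.
have A_starI c i : i \notin I -> GRing.comm A (star c I i).
  by move=> iI; apply: antisym_on_star_comm => // s b; apply: ext_perm_codom.
have A_starJ c i : i \notin I -> GRing.comm A (star c J i).
  move=> iI; apply: antisym_on_star_comm => // s b bJ.
  by rewrite ext_perm_disjoint // JI.
have E_starI c i : i \notin J -> GRing.comm E (star c I i).
  move=> iJ; apply: antisym_on_star_comm => // s b bI.
  by rewrite ext_perm_disjoint // IJ.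
have E_transp i j : i \notin J -> j \notin J -> GRing.comm E (transp F i j).
  move=> iJ jJ; apply/commr_sym/comm_antisym_on => s; apply/commr_sym.
  by rewrite /GRing.comm pbasis_transp !ext_perm_disjoint.
have EA : GRing.comm E A.
  apply: comm_antisym_on => s; apply/commr_sym/comm_antisym_on => t.
  rewrite /GRing.comm !pbasis_mul; congr (pbasis F _); apply/permP=> b; rewrite !permM.
  have [/[dup] bI /IJ bJ|bI] := boolP (b \in I).
    by rewrite !(@ext_perm_disjoint N _ _ g_inj) // IJ // ext_perm_codom.
  rewrite (@ext_perm_disjoint N _ _ f_inj _ b) // ext_perm_disjoint //.
  have [bJ|bJ] := boolP (b \in J); first by rewrite JI // ext_perm_codom.
  by rewrite ext_perm_disjoint.
(* The last of the [m.+1] arguments of the row at [pt a] has to be [x a]. *)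
pose t a := x a - m%:R * h.
pose X a := rprod (star h [:: pt a]) h (t a) I.
pose R := rprod (star h J) h w' I.
pose R' := Rinv J h w' I.
have skew_corner (y0 : B) : {in I &, forall i j, i != j ->
    A * y0 * transp F i j = - (A * y0)} -> A * y0 * A = A * y0.
  move=> skew; apply: antisym_absorb => // i j ij.
  by apply: skew; rewrite ?codom_f // inj_eq.
have XA a : a \in Z -> A * X a * A = A * X a.
  move=> aZ; have [aI _] := Zfg aZ; apply/skew_corner/rprod_skew => // i iI.
  by rewrite inE; apply: contraNneq aI => <-.
have AR : A * R * A = A * R by apply/skew_corner/rprod_skew.
have AR' : A * R' * A = A * R'.
  apply/skew_corner => i j iI jI; apply: rprod_skew; rewrite ?rev_uniq ?mem_rev //.
    by move=> i0; rewrite mem_rev; apply: IJ.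
  by move=> i0 j0; rewrite !mem_rev; apply: skewA.
have szI : size I = m.+1 by rewrite size_codom card_ord.
have szJ : size J = k by rewrite size_codom card_ord.
have L'A a : a \in Z -> GRing.comm A (L' a).
  by move=> /Zfg[aI _]; apply/comm_shift/A_starJ.
have EX a : a \in Z -> GRing.comm E (X a).
  move=> /Zfg[aI aJ]; apply: comm_rprod => i /IJ iJ; apply: comm_starr => b.
  by rewrite inE => /eqP ->; apply: E_transp.
have EL' a : a \in Z -> GRing.comm E (L' a).
  by move=> /Zfg[aI aJ]; apply/comm_shift/E_star.
have fuse a : a \in Z -> A * X a =
    (\prod_(j < m) (x a - m%:R * h + j%:R * h)) *: (A * L a).
  move=> aZ; have [aI _] := Zfg aZ; rewrite /X /L.
  move: szI aI uI skewA; rewrite -/I; case: I => // i s [szs] aI uI skewI.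
  by rewrite (rprod_fusion h (t a) uI aI skewI) szs /t subrK.
pose W := \prod_(a <- Z) (X a * L' a); pose W' := \prod_(a <- Z) (L' a * X a).
have RW : E * (R * W) = E * (W' * R).
  apply: (intertwine uJ skewE E_star E_transp (pt := pt) (t := t) uI IJ) => a aZ.
  by have [aI aJ] := Zfg aZ; split=> //; rewrite szJ /w' -(xy aZ) /t; ring.
have AW' : A * W' * A = A * W'.
  apply: corner_prod => // a aZ.
  by rewrite mulrA L'A // -!mulrA; congr (_ * _); rewrite mulrA XA.
have [RR' R'R] := R_mul_Rinv h uJ skewE E_star w' IJ.
have ER : GRing.comm E R by apply: comm_rprod => i /IJ; apply: E_star.
have ER' : GRing.comm E R'.
  by apply: comm_rprod => i; rewrite mem_rev => /IJ; apply: E_star.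
have EW' : GRing.comm E W'.
  rewrite /W' big_seq; apply: commr_prod => a aZ.
  by apply: commrM; [apply: EL' | apply: EX].
have cyc_ext (q : nat) (u : 'I_q -> 'I_N) (u_inj : injective u) :
    {in Z, forall a, pt a \notin codom u} -> cyclic_for phi (antisym_on F u_inj).
  move=> Zu; rewrite antisym_onE; apply/cyclicZ/cyclic_sum => s _; apply/cyclicZ.
  by apply: phi_cyclic => a aZ; apply/ext_perm_disjoint/Zu.
have cycR : cyclic_for phi R.
  suffices cycS s v : {subset s <= I} -> cyclic_for phi (rprod (star h J) h v s).
    exact: cycS.
  elim: s v => [|i s IH] v sI /=; first exact: cyclic1.
  have iI := sI i (mem_head _ _).
  apply: cyclicM; last by apply: IH => j js; apply: sI; rewrite inE js orbT.
  apply: cyclicD; first exact/cyclicZ/cyclic1.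
  apply/cyclicZ/cyclic_sum => b bJ; apply: phi_cyclic => a aZ.
  have [aI aJ] := Zfg aZ; rewrite tpermD //; last by apply: contraNneq aJ => <-.
  by apply: contraNneq aI => <-.
have exch : phi (A * E * W) = phi (A * E * W').
  rewrite szI in RR' R'R; apply: (scalerI d_neq0).
  have cycA : cyclic_for phi A by apply: cyc_ext => a /Zfg[].
  have cycE : cyclic_for phi E by apply: cyc_ext => a /Zfg[].
  exact: (corner_exchange AA AR AR' AW' EA ER ER' EW' RR' R'R RW cycA cycE cycR).
have AL a : a \in Z -> GRing.comm A (L a).
  by move=> /Zfg[aI _]; apply/comm_shift/A_starI.
pose kappa a := \prod_(j < m) (x a - m%:R * h + j%:R * h).
pose c := \prod_(a <- Z) kappa a.
have fuseW : A * E * W = c *: (A * E * \prod_(a <- Z) (L a * L' a)).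
  rewrite -EA -!(mulrA E A) scalerAr; congr (E * _); apply: fuse_prod => a aZ.
    by rewrite mulrA fuse // -scalerAl mulrA.
  by apply: commrM; [apply: AL | apply: L'A].
have fuseW' : A * E * W' = c *: (A * E * \prod_(a <- Z) (L' a * L a)).
  rewrite -EA -!(mulrA E A) scalerAr; congr (E * _); apply: fuse_prod => a aZ.
    by rewrite [LHS]mulrA L'A // -(mulrA (L' a)) fuse // -scalerAr !mulrA -L'A.
  by apply: commrM; [apply: L'A | apply: AL].
have phiZ u : phi (c *: u) = c *: phi u by exact: linearZ.
have exch' : phi (A * E * \prod_(a <- Z) (L a * L' a)) =
    phi (A * E * \prod_(a <- Z) (L' a * L a)).
  apply: (scalerI kappa_neq0); apply: etrans (esym (phiZ _)) _.
  by apply: etrans (phiZ _); apply: etrans (congr1 phi fuseW'); rewrite -exch fuseW.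
have LL' : {in Z &, forall a b, a != b -> GRing.comm (L a) (L' b)}.
  move=> a b /Zfg[aI aJ] /Zfg[bI bJ] ab; apply: comm_shiftl; apply: comm_shift.
  by apply: star_comm; rewrite ?inj_eq.
have L'L : {in Z &, forall a b, a != b -> GRing.comm (L' a) (L b)}.
  by move=> a b aZ bZ ab; apply/commr_sym/(LL' b a bZ aZ); rewrite eq_sym.
have EL : GRing.comm E (\prod_(a <- Z) L a).
  rewrite big_seq; apply: commr_prod => a /Zfg[aI aJ].
  by apply: comm_shift; apply: E_starI.
have AL' : GRing.comm A (\prod_(a <- Z) L' a).
  by rewrite big_seq; apply: commr_prod => a; apply: L'A.
move: exch'; rewrite -(prod_merge uZ LL') -(prod_merge uZ L'L) => exch'.
exact: regroup_exchange (EA : E * A = A * E) EL AL' exch'.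
Qed.

End Exchange.

(** * First return *)

Section FirstReturn.
Variables (n N : nat) (f : 'I_n -> 'I_N).

(** First return to the image of [f], in inductive form: statements about
   truncated permutations become inductions along the path. *)
Inductive hop (s : 'S_N) : 'I_N -> 'I_n -> Prop :=
| hop_in x b : s x = f b -> hop s x b
| hop_out x b : (forall a, f a != s x) -> hop s (s x) b -> hop s x b.

Lemma hop_inj s x b c : injective f -> hop s x b -> hop s x c -> b = c.
Proof.
move=> f_inj sb; elim: sb c => {x b} [x b sx|x b sx sb IH] c sc.
  case: sc sx => {x c} [x c ->|x c sx _ def_sx]; first by move/f_inj.
  by have := sx b; rewrite def_sx eqxx.
apply: IH; case: sc sx => {x c sb} // x c sx /(_ c).
by rewrite sx eqxx.
Qed.

Lemma hop_conj s (r : 'S_N) x b : (forall a, r (f a) = f a) ->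
  hop s x b -> hop (s ^ r)%g (r x) b.
Proof.
move=> rf; elim=> {x b} [x b sx|x b sx _ IH].
  by apply: hop_in; rewrite permJ sx rf.
apply: hop_out; rewrite permJ // => a.
by rewrite -rf (inj_eq perm_inj).
Qed.

End FirstReturn.

Section Truncation.
Variables n m : nat.
Implicit Types s : 'S_(n + m).
Local Notation iota_n := (@lshift n m).
Local Notation ext := (ext_perm (@lshift_inj n m)).

Lemma hop_trunc s a : hop iota_n s (lshift m a) (trunc_perm s a).
Proof.
(* After [a] itself, the cycle of [a] is walked up to the first symbol it keeps. *)
have walk q x : iter q s (s x) = lshift m a ->
    hop iota_n s x (head a (pmap insub [seq val y | y <- traject s (s x) q])).
  elim: q x => [|q IH] x /=; first exact: hop_in.
  rewrite -iterS iterSr => /IH hop_q; case: insubP => [b _ def_b|lt_n] /=.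
    by apply: hop_in; apply: val_inj.
  by apply: hop_out => // b; apply: contraNneq lt_n => <- /=.
rewrite permE /trunc_fun /trunc_cycle /fingraph.orbit -fingraph.orderSpred /=.
rewrite -[nat_of_ord a]/(val a) valK /=; set r := pmap _ _.
have -> : next_at a a a r = head a r by case: (r) => /= *; rewrite eqxx.
by apply: walk; rewrite -iterSr fingraph.orderSpred fingraph.iter_order //; apply: perm_inj.
Qed.

Lemma trunc_permP s (t : 'S_n) :
  (forall a, hop iota_n s (lshift m a) (t a)) -> trunc_perm s = t.
Proof.
move=> st; apply/permP=> a.
exact: hop_inj (@lshift_inj n m) (hop_trunc s a) (st a).
Qed.

Lemma trunc_mul_ext s t : trunc_perm (ext t * s)%g = (t * trunc_perm s)%g.
Proof.
apply: trunc_permP => a; rewrite permM.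
have: ext t (lshift m a) = lshift m (t a) by rewrite ext_perm_in.
elim: (hop_trunc s (t a)) (lshift m a) => {a} x b sx; last first.
  move=> _ IH y def_x; apply: hop_out; first by rewrite permM def_x.
  by rewrite permM def_x; apply: IH; rewrite ext_perm_out.
by move=> y def_x; apply: hop_in; rewrite permM def_x.
Qed.

Lemma trunc_ext_mul s t : trunc_perm (s * ext t)%g = (trunc_perm s * t)%g.
Proof.
apply: trunc_permP => a; rewrite permM.
elim: (hop_trunc s a) => {a} x b sx.
  by apply: hop_in; rewrite permM sx ext_perm_in.
by move=> _ IH; apply: hop_out; rewrite permM ext_perm_out.
Qed.

(** * Cycles lost by truncation *)

(** The cycles that truncation erases altogether; their number is the exponent of
   [p] in the partial trace. *)
Definition loose s : {set {set 'I_(n + m)}} :=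
  [set C in porbits s | [forall a, lshift m a \notin C]].

Lemma card_porbits_loose s : #|porbits s| = (#|porbits (trunc_perm s)| + #|loose s|)%N.
Proof.
pose tight := [set C in porbits s | [exists a, lshift m a \in C]].
pose restr (C : {set 'I_(n + m)}) : {set 'I_n} := [set b | lshift m b \in C].
have porbit_mem C x : C \in porbits s -> x \in C -> C = porbit s x.
  by case/imsetP=> y _ ->; rewrite -eq_porbit_mem => /eqP ->.
have -> : porbits (trunc_perm s) = restr @: tight.
  apply/setP=> D; apply/imsetP/imsetP=> [[a _ ->]|[C]].
    exists (porbit s (lshift m a)); last exact: porbit_trunc.
    by rewrite inE imset_f //; apply/existsP; exists a; apply: porbit_id.
  rewrite inE => /andP[sC /existsP[a aC]] ->; exists a => //.
  by rewrite porbit_trunc (porbit_mem _ _ sC aC).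
rewrite card_in_imset => [|C D]; last first.
  rewrite !inE => /andP[sC /existsP[a aC]] /andP[sD _] eqCD.
  have aD : lshift m a \in D by move/setP/(_ a): eqCD; rewrite !inE aC => <-.
  by rewrite (porbit_mem _ _ sC aC) (porbit_mem _ _ sD aD).
rewrite -(cardsID [set C : {set _} | [exists a, lshift m a \in C]] (porbits s)).
congr (_ + _)%N; apply: eq_card => C; rewrite !inE // negb_exists andbC.
by congr (_ && _).
Qed.

End Truncation.

Lemma porbit_equivariant M N (s : 'S_M) (t : 'S_N) (u : 'I_M -> 'I_N) x :
  {in porbit s x, forall y, t (u y) = u (s y)} -> porbit t (u x) = u @: porbit s x.
Proof.
move=> tu; have iter_u i : (t ^+ i)%g (u x) = u ((s ^+ i)%g x).
  elim: i => [|i IH]; first by rewrite !expg0 !perm1.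
  by rewrite !expgSr !permM IH tu ?mem_porbit.
apply/setP=> y; apply/porbitP/imsetP => [[i ->]|[x' /porbitP[i ->] ->]].
  by rewrite iter_u; exists ((s ^+ i)%g x); rewrite ?mem_porbit.
by exists i; rewrite iter_u.
Qed.

Lemma card_porbits_conj N (s r : 'S_N) : #|porbits (s ^ r)%g| = #|porbits s|.
Proof.
have rs x : porbit (s ^ r)%g (r x) = r @: porbit s x.
  by apply: porbit_equivariant => y _; rewrite permJ.
have -> : porbits (s ^ r)%g = (fun C : {set 'I_N} => r @: C) @: porbits s.
  apply/setP=> D; apply/imsetP/imsetP => [[x _ ->]|[_ /imsetP[x _ ->] ->]].
    exists (porbit s (r^-1%g x)); first exact: imset_f.
    by rewrite -rs permKV.
  by exists (r x); rewrite // rs.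
by rewrite card_imset //; apply/imset_inj/perm_inj.
Qed.

Section Loose.
Variables n m : nat.
Implicit Types s : 'S_(n + m).
Local Notation ext := (ext_perm (@lshift_inj n m)).

Lemma loose_sub s (t : 'S_(n + m)) :
  (forall x, (forall a, lshift m a != x) -> (forall a, lshift m a != s x) -> t x = s x) ->
  loose s \subset loose t.
Proof.
move=> ts; apply/subsetP=> C; rewrite !inE => /andP[/imsetP[x _ ->] /forallP sx].
have out y : y \in porbit s x -> forall a, lshift m a != y.
  by move=> sy a; apply: contraTneq sy => <-; apply: sx.
have def_C : porbit t x = porbit s x.
  rewrite -[RHS]imset_id; apply: (@porbit_equivariant _ _ s t id x) => y sy.
  apply: ts; apply: out => //.
  by case/porbitP: sy => i ->; rewrite -permM -expgSr mem_porbit.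
by rewrite -def_C imset_f //=; apply/forallP=> a; rewrite def_C sx.
Qed.

Lemma loose_mul_ext s t : loose (ext t * s)%g = loose s.
Proof.
apply/eqP; rewrite eqEsubset; apply/andP; split; apply: loose_sub => x fx _;
  by rewrite permM ext_perm_out.
Qed.

Lemma loose_ext_mul s t : loose (s * ext t)%g = loose s.
Proof.
apply/eqP; rewrite eqEsubset; apply/andP; split; apply: loose_sub => x _.
  rewrite permM; case: (codom_case (@lshift n m) (s x)) => [[b ->] fx|fx _].
    by have := fx (t b); rewrite ext_perm_in eqxx.
  by rewrite ext_perm_out.
by move=> fx; rewrite permM ext_perm_out.
Qed.

End Loose.

(** * The partial trace *)

Section PartialTrace.
Variables (F : fieldType) (p : F).

Section Tr.
Variables n m : nat.

Fact Tr_is_linear : linear (@Tr F n m p).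
Proof.
move=> c x y; rewrite /Tr scaler_sumr -big_split; apply: eq_bigr => s _.
by rewrite /= permalgD permalgZ scalerA -scalerDl mulrDl mulrA.
Qed.

HB.instance Definition _ :=
  GRing.isLinear.Build F (permalg F (n + m)) (permalg F n) *:%R (@Tr F n m p)
    Tr_is_linear.

Lemma Tr_basis s :
  Tr p (pbasis F s) = p ^+ #|@loose n m s| *: pbasis F (trunc_perm s).
Proof.
rewrite /Tr (bigD1 s) //= big1 => [|t ts].
  by rewrite pbasisE eqxx mul1r addr0 card_porbits_loose addKn.
by rewrite pbasisE (negPf ts) mul0r scale0r.
Qed.

Lemma Tr_mulr (x : permalg F (n + m)) (y : permalg F n) :
  Tr p (x * ext_alg (@lshift_inj n m) y) = Tr p x * y.
Proof.
rewrite (permalg_expand x) mulr_suml !(linear_sum (Tr p)) mulr_suml.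
apply: eq_bigr => s _; rewrite (permalg_expand y) (linear_sum (ext_alg _)) !mulr_sumr.
rewrite (linear_sum (Tr p)); apply: eq_bigr => t _.
rewrite !linearZ /= -!scalerAr -!scalerAl !linearZ /= ext_alg_basis pbasis_mul.
rewrite !Tr_basis -scalerAl pbasis_mul loose_mul_ext trunc_mul_ext.
by rewrite !scalerA (mulrC (y t)).
Qed.

Lemma Tr_mull (x : permalg F (n + m)) (y : permalg F n) :
  Tr p (ext_alg (@lshift_inj n m) y * x) = y * Tr p x.
Proof.
rewrite (permalg_expand x) mulr_sumr !(linear_sum (Tr p)) mulr_sumr.
apply: eq_bigr => s _; rewrite (permalg_expand y) (linear_sum (ext_alg _)) !mulr_suml.
rewrite (linear_sum (Tr p)); apply: eq_bigr => t _.
rewrite !linearZ /= -!scalerAr -!scalerAl !linearZ /= ext_alg_basis pbasis_mul.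
rewrite !Tr_basis -scalerAr pbasis_mul loose_ext_mul trunc_ext_mul.
by rewrite !scalerA (mulrC (y t)).
Qed.

End Tr.

Section TwoTraces.
Variables n m k : nat.

(** The [k] points of the second factor are placed after the [m] points of the
   first one. *)
Definition skip (x : 'I_(n + k)) : 'I_((n + m) + k) :=
  match split x with
  | inl a => lshift k (lshift m a)
  | inr j => rshift (n + m) j
  end.

Lemma skip_l a : skip (lshift k a) = lshift k (lshift m a).
Proof.
by rewrite /skip; case: split_ordP => b /eqP; rewrite ?eq_lrshift // eq_lshift => /eqP ->.
Qed.

Lemma skip_r j : skip (rshift n j) = rshift (n + m) j.
Proof.
by rewrite /skip; case: split_ordP => b /eqP; rewrite ?eq_rlshift // eq_rshift => /eqP ->.
Qed.

Fact skip_inj : injective skip.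
Proof.
move=> x y; case: (split_ordP x) => a ->; case: (split_ordP y) => b ->.
all: rewrite ?skip_l ?skip_r => /eqP.
all: rewrite ?eq_lshift ?eq_rshift ?eq_lrshift ?eq_rlshift //.
  by move/eqP->.
by move/eqP->.
Qed.

Lemma trunc_skip (s : 'S_(n + k)) :
  trunc_perm (ext_perm skip_inj s) = ext_perm (@lshift_inj n m) (trunc_perm s).
Proof.
apply: trunc_permP => x; case: (split_ordP x) => [a|i] ->; last first.
  have no_i y : skip y != lshift k (rshift n i).
    case: (split_ordP y) => b ->; rewrite ?skip_l ?skip_r ?eq_rlshift //.
    by rewrite eq_lshift eq_lrshift.
  rewrite [X in hop _ _ _ X]ext_perm_out; last by move=> a; rewrite eq_lrshift.
  by apply: hop_in; rewrite ext_perm_out.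
rewrite ext_perm_in -skip_l; elim: (hop_trunc s a) => {a} x0 b sx.
  by apply: hop_in; rewrite ext_perm_in sx skip_l.
move=> _ IH; apply: hop_out; rewrite ext_perm_in // => y.
case: (split_ordP (s x0)) sx => [a -> /(_ a)/eqP //|j -> _].
by rewrite skip_r eq_lrshift.
Qed.

Lemma card_loose_skip (s : 'S_(n + k)) :
  #|@loose (n + m) k (ext_perm skip_inj s)| = #|@loose n k s|.
Proof.
have skip_porbit x : porbit (ext_perm skip_inj s) (skip x) = skip @: porbit s x.
  by apply: porbit_equivariant => y _; rewrite ext_perm_in.
rewrite -(card_imset (mem (loose s)) (imset_inj skip_inj)); apply: eq_card => C.
rewrite inE; apply/andP/imsetP => [[/imsetP[x' _ ->] /forallP sC]|[D]].
  case: (split_ordP x') sC => [a -> /(_ a)|j ->]; first by rewrite porbit_id.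
  rewrite -skip_r skip_porbit => sC; exists (porbit s (rshift n j)) => //.
  rewrite inE imset_f //=; apply/forallP=> a; apply: contra (sC (lshift m a)) => sa.
  by rewrite -skip_l imset_f.
rewrite inE => /andP[/imsetP[x _ ->] /forallP sD] ->; split.
  by rewrite -skip_porbit imset_f.
apply/forallP=> y; apply/imsetP=> -[x' sx' def_y].
case: (split_ordP x') sx' def_y => [a -> sa _|j -> _]; first by have := sD a; rewrite sa.
by rewrite skip_r => /eqP; rewrite eq_lrshift.
Qed.

Lemma Tr_skip (x : permalg F (n + k)) :
  Tr p (ext_alg skip_inj x) = ext_alg (@lshift_inj n m) (Tr p x).
Proof.
have := @linear_basis_eq F _ _ (@Tr F (n + m) k p \o ext_alg skip_inj)
  (ext_alg (@lshift_inj n m) \o @Tr F n k p).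
apply=> s /=; rewrite ext_alg_basis !Tr_basis linearZ /= ext_alg_basis.
by rewrite trunc_skip card_loose_skip.
Qed.

Definition double_Tr (x : permalg F ((n + m) + k)) : permalg F n :=
  Tr p (Tr p x : permalg F (n + m)).

Fact double_Tr_is_linear : linear double_Tr.
Proof. by move=> c x y; rewrite /double_Tr !linearP. Qed.

HB.instance Definition _ :=
  GRing.isLinear.Build F (permalg F ((n + m) + k)) (permalg F n) *:%R double_Tr
    double_Tr_is_linear.

(** A first return of the first return map is a first return. *)
Lemma hop_double_trunc (s : 'S_((n + m) + k)) a :
  hop (@lshift (n + m) k \o @lshift n m) s (lshift k (lshift m a))
    (trunc_perm (trunc_perm s) a).
Proof.
have step x c b : hop (@lshift (n + m) k) s x c ->
    (c = lshift m b) \/ (forall a0, lshift m a0 != c) /\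
       hop (@lshift (n + m) k \o @lshift n m) s (lshift k c) b ->
    hop (@lshift (n + m) k \o @lshift n m) s x b.
  elim=> {x c} [x c sx|x c sx _ IH] cb; last first.
    apply: hop_out; last exact: IH.
    by move=> a0; apply: sx.
  case: cb => [def_c|[out_c hop_c]]; first by apply: hop_in; rewrite sx def_c.
  by apply: hop_out; rewrite sx // => a0; rewrite /= (inj_eq (@lshift_inj _ _)).
elim: (hop_trunc (trunc_perm s) a) => {a} x b sx.
  by apply: step (hop_trunc s x) _; left.
by move=> hop_tr IH; apply: step (hop_trunc s x) _; right.
Qed.

(** Conjugation by a permutation that fixes the first [n] points changes neither
   the first returns to these points nor the number of cycles. *)
Lemma double_Tr_cyclic (r : 'S_((n + m) + k)) (x : permalg F ((n + m) + k)) :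
  (forall a, r (lshift k (lshift m a)) = lshift k (lshift m a)) ->
  double_Tr (pbasis F r * x) = double_Tr (x * pbasis F r).
Proof.
move=> rf; rewrite (permalg_expand x) mulr_sumr mulr_suml !(linear_sum double_Tr).
apply: eq_bigr => s _; rewrite -scalerAr -scalerAl !linearZ /=; congr (_ *: _).
rewrite !pbasis_mul; have -> : (r * s)%g = ((s * r) ^ (r^-1))%g.
  by rewrite conjgE invgK mulgK.
move: (s * r)%g => {}s; set q := (r^-1)%g.
have qf a : q (lshift k (lshift m a)) = lshift k (lshift m a).
  by apply: (@perm_inj _ r); rewrite permKV rf.
have trq : trunc_perm (trunc_perm (s ^ q)%g) = trunc_perm (trunc_perm s).
  apply/permP=> a; apply: (hop_inj _ (hop_double_trunc (s ^ q)%g a)).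
    exact: inj_comp (@lshift_inj _ _) (@lshift_inj _ _).
  by rewrite -[in X in hop _ _ X]qf; apply: hop_conj => //; apply: hop_double_trunc.
have double_Tr_basis t : double_Tr (pbasis F t) =
    p ^+ (#|porbits t| - #|porbits (trunc_perm (trunc_perm t))|) *:
      pbasis F (trunc_perm (trunc_perm t)).
  rewrite /double_Tr Tr_basis linearZ /= Tr_basis scalerA -exprD.
  by congr (p ^+ _ *: _); rewrite !card_porbits_loose -(addnA #|_|) addKn [RHS]addnC.
by rewrite !double_Tr_basis trq card_porbits_conj.
Qed.

(** A partial trace is a map of bimodules over the permutations of the points that
   it keeps, and it commutes with the insertion of fixed points. *)
Lemma Tr_mul_Tr (x : permalg F (n + m)) (y : permalg F (n + k)) :
  Tr p x * Tr p y = double_Tr (ext_alg (@lshift_inj (n + m) k) x * ext_alg skip_inj y).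
Proof. by rewrite /double_Tr Tr_mull Tr_skip Tr_mulr. Qed.

Lemma Tr_mul_Tr_rev (x : permalg F (n + m)) (y : permalg F (n + k)) :
  Tr p y * Tr p x = double_Tr (ext_alg skip_inj y * ext_alg (@lshift_inj (n + m) k) x).
Proof. by rewrite /double_Tr Tr_mulr Tr_skip Tr_mull. Qed.

End TwoTraces.
End PartialTrace.

(** * Polynomials over an algebra at scalar arguments *)

Section ScalarArguments.
Variables (F : fieldType) (B : algType F).
Implicit Types (P Q : {poly B}) (u : F).

Lemma horner_scalarM P Q u : (P * Q).[u%:A] = P.[u%:A] * Q.[u%:A].
Proof. by apply: hornerM_comm; apply/comm_alg. Qed.

Lemma horner_map_linear (C : algType F) (f : {linear B -> C}) P u :
  (map_poly f P).[u%:A] = f P.[u%:A].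
Proof.
rewrite /map_poly horner_poly horner_coef linear_sum; apply: eq_bigr => i _.
by rewrite !exprZn !expr1n !mulr_algr linearZ.
Qed.

End ScalarArguments.

Lemma poly_eq0_of_values (F : numFieldType) (P : {poly F}) :
  (forall u, P.[u] = 0) -> P = 0.
Proof.
move=> P0; apply/eqP/negPn/negP => nzP.
pose r : seq F := mkseq (fun i => i%:R) (size P).
suffices: (size r < size P)%N by rewrite size_mkseq ltnn.
apply: max_poly_roots nzP _ _; first by apply/allP=> u _; apply/rootP.
by apply: mkseq_uniq => i j /eqP; rewrite eqr_nat => /eqP.
Qed.

(** Each coordinate of [P] is a scalar polynomial whose product with [c] has
   infinitely many roots. *)
Lemma permalg_poly_eq0 (F : numFieldType) n (c : {poly F}) (P : {poly permalg F n}) :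
  c != 0 -> (forall u, c.[u] != 0 -> P.[u%:A] = 0) -> P = 0.
Proof.
move=> c0 P0; apply/polyP => i; rewrite coef0; apply/ffunP => s.
rewrite [RHS]ffunE; pose Ps := \poly_(j < size P) (P`_j s : F).
have Ps_val u : Ps.[u] = P.[u%:A] s.
  rewrite horner_poly horner_coef permalg_sumE; apply: eq_bigr => j _.
  by rewrite exprZn expr1n mulr_algr permalgZ mulrC.
have: c * Ps = 0.
  apply: poly_eq0_of_values => u; rewrite hornerM Ps_val.
  have [-> |/P0 ->] := eqVneq c.[u] 0; first by rewrite mul0r.
  by rewrite [X in _ * X]ffunE mulr0.
move/eqP; rewrite mulf_eq0 (negPf c0) => /eqP/polyP/(_ i).
rewrite coef0 coef_poly; case: ltnP => // le_i _.
by rewrite nth_default // ffunE.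
Qed.

Lemma natr_fact_neq0 (F : numFieldType) q : q`!%:R != 0 :> F.
Proof. by rewrite pnatr_eq0 -lt0n fact_gt0. Qed.

(** * Commutation of the transfer matrices *)

Section Commutation.
Variables (F : numFieldType) (n : nat) (z : 'I_n -> F) (h p : F).

Lemma Tpoly_value q u :
  (Tpoly z h p q).[u%:A] =
    Tr p (theta n (antisym F q) *
      \prod_(a < n) ((u - z (rev_ord a))%:A + h *: \sum_(i < q)
         pbasis F (tperm (lshift q (rev_ord a)) (rshift n i)))).
Proof.
rewrite /Tpoly horner_map_linear; congr (Tr p _).
rewrite horner_scalarM hornerC; congr (_ * _).
rewrite (big_morph (fun P => P.[u%:A]) (fun P Q => horner_scalarM P Q u) (hornerC _ _)).
apply: eq_bigr => a _; rewrite /Tfactor !hornerE.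
by rewrite scalerBl.
Qed.

Lemma star_codom N q (f : 'I_q -> 'I_N) a :
  star h (codom f) a = h *: \sum_i transp F a (f i).
Proof. by rewrite /star big_image. Qed.

Lemma ext_alg_shift q M N (g : 'I_M -> 'I_N) (g_inj : injective g) c (t : 'I_q -> 'S_M) :
  ext_alg g_inj (c%:A + h *: \sum_i pbasis F (t i)) =
  c%:A + h *: \sum_i pbasis F (ext_perm g_inj (t i)).
Proof.
rewrite rmorphD /= !linearZ /= rmorph1 (linear_sum (ext_alg g_inj)) /=.
by congr (_ + h *: _); apply: eq_bigr => i _; rewrite ext_alg_basis.
Qed.

Lemma ext_alg_prefactor q N (g : 'I_(n + q) -> 'I_N) (g_inj : injective g)
    (f : 'I_q -> 'I_N) (f_inj : injective f) (pt : 'I_n -> 'I_N) u :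
  g \o @rshift n q =1 f -> (forall a, g (lshift q (rev_ord a)) = pt a) ->
  ext_alg g_inj (theta n (antisym F q) *
      \prod_(a < n) ((u - z (rev_ord a))%:A + h *: \sum_(i < q)
         pbasis F (tperm (lshift q (rev_ord a)) (rshift n i)))) =
  antisym_on F f_inj *
    \prod_(a < n) ((u - z (rev_ord a))%:A + star h (codom f) (pt a)).
Proof.
move=> gf gpt; rewrite rmorphM rmorph_prod /= theta_ext; congr (_ * _).
  exact: ext_alg_comp.
apply: eq_bigr => a _; rewrite ext_alg_shift star_codom; congr (_ + h *: _).
by apply: eq_bigr => i _; rewrite ext_tperm gpt -gf.
Qed.

Variables m k : nat.
Local Notation N := ((n + m.+1) + k)%N.

Let point (a : 'I_n) : 'I_N := lshift k (lshift m.+1 (rev_ord a)).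
Let auxl (i : 'I_m.+1) : 'I_N := lshift k (rshift n i).
Let auxr (j : 'I_k) : 'I_N := rshift (n + m.+1) j.

Lemma Tpoly_comm_values u v :
  \prod_(a < n) \prod_(j < m) (u - z (rev_ord a) - m%:R * h + j%:R * h) != 0 ->
  Rscalar (codom auxr) h (u - v - m%:R * h + h * (k%:R - 1)) m.+1 != 0 ->
  GRing.comm (Tpoly z h p m.+1).[u%:A] (Tpoly z h p k).[v%:A].
Proof.
move=> kappa_neq0 d_neq0.
have auxl_inj : injective auxl by move=> i j /lshift_inj/rshift_inj.
have auxr_inj : injective auxr by apply: rshift_inj.
have point_inj : injective point by move=> a b /lshift_inj/lshift_inj/rev_ord_inj.
have lr i j : auxl i != auxr j by rewrite eq_lrshift.
have prel := ext_alg_prefactor (@lshift_inj (n + m.+1) k) auxl_inj (pt := point) u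
  (fun=> erefl) (fun=> erefl).
have prer := ext_alg_prefactor (@skip_inj n m.+1 k) auxr_inj (pt := point) v
  (@skip_r n m.+1 k) (fun a => skip_l m.+1 k (rev_ord a)).
rewrite /GRing.comm !Tpoly_value.
rewrite [LHS]Tr_mul_Tr [RHS]Tr_mul_Tr_rev prel prer.
apply: (exchange auxl_inj auxr_inj lr (natr_fact_neq0 _ _) (pt := point)
  (Z := index_enum 'I_n) (phi := @double_Tr F p n m.+1 k) (w := u - v)
  (x := fun a => u - z (rev_ord a)) (y := fun a => v - z (rev_ord a))
  point_inj (index_enum_uniq _)) => //.
- move=> a _; split; apply/codomP=> -[i /eqP]; last by rewrite eq_lrshift.
  by rewrite (inj_eq (@lshift_inj _ _)) eq_lrshift.
- move=> s sa x; apply: double_Tr_cyclic => a.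
  by have := sa (rev_ord a) (mem_index_enum _); rewrite /point rev_ordK.
by move=> a _; ring.
Qed.

(* The values of the spectral parameter [u] for which, [v] being given, the fusion
   or the inversion of the R-matrix degenerates. *)
Let bad (v : F) : {poly F} :=
  (\prod_(a < n) \prod_(j < m) ('X - (z (rev_ord a) + m%:R * h - j%:R * h)%:P)) *
  \prod_(j < m.+1) (('X - (v + m%:R * h - h * (k%:R - 1) - j%:R * h + h * k%:R)%:P) *
                    ('X - (v + m%:R * h - h * (k%:R - 1) - j%:R * h - h)%:P)).

Let bad_neq0 v : bad v != 0.
Proof.
apply/monic_neq0/rpredM; apply: monic_prod => i _; first by apply: monic_prod_XsubC.
by rewrite rpredM ?monicXsubC.
Qed.

(** For a given [v], the commutator of the values is a polynomial in [u] that
   vanishes off the roots of [bad v]; the coefficients of one polynomial thus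
   commute with all values of the other. *)
Lemma Tpoly_coef_comm i j : GRing.comm (Tpoly z h p m.+1)`_i (Tpoly z h p k)`_j.
Proof.
set P := Tpoly z h p m.+1; set Q := Tpoly z h p k.
have comm_values u v : (bad v).[u] != 0 -> GRing.comm P.[u%:A] Q.[v%:A].
  rewrite /bad hornerM !horner_prod mulf_eq0 negb_or => /andP[kappa_neq0 d_neq0].
  apply: Tpoly_comm_values.
    rewrite (eq_bigr _ (fun a _ => horner_prod _ _ _ _)) in kappa_neq0.
    apply: contraNneq kappa_neq0 => <-; apply/eqP; apply: eq_bigr => a _.
    apply: eq_bigr => b _.
    by rewrite hornerXsubC; ring.
  apply: contraNneq d_neq0 => <-; apply/eqP; apply: eq_bigr => b _.
  by rewrite hornerM !hornerXsubC size_codom card_ord; congr (_ * _); ring.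
have comm_coef v : GRing.comm P`_i Q.[v%:A].
  have : P * (Q.[v%:A])%:P - (Q.[v%:A])%:P * P = 0.
    apply: (permalg_poly_eq0 (bad_neq0 v)) => u /comm_values uv.
    by rewrite !hornerE /= !horner_scalarM !hornerC uv subrr.
  move/polyP/(_ i); rewrite coefB coefMC coefCM coef0 => /eqP.
  by rewrite subr_eq0 => /eqP.
have : (P`_i)%:P * Q - Q * (P`_i)%:P = 0.
  apply: (permalg_poly_eq0 (oner_neq0 _)) => v _.
  by rewrite !hornerE /= !horner_scalarM !hornerC comm_coef subrr.
move/polyP/(_ j); rewrite coefB coefMC coefCM coef0 => /eqP.
by rewrite subr_eq0 => /eqP.
Qed.

End Commutation.

Theorem Bethe_comm (F : numFieldType) n (z : 'I_n -> F) (h p : F) (x y : permalg F n) :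
  x \in Bethe z h p -> y \in Bethe z h p -> x * y = y * x.
Proof.
rewrite /Bethe; set gens := [seq Tcoef z h p m i | m <- _, i <- _].
have gens_comm : {in gens &, commutative *%R}.
  move=> _ _ /allpairsP[[q i] /= [q_pos _ ->]] /allpairsP[[r j] /= [_ _ ->]].
  case: q q_pos => [|q _]; first by rewrite mem_iota.
  exact: Tpoly_coef_comm.
have span_cent a : a \in gens -> (<<gens>> <= 'C[a])%VS.
  by move=> ga; apply/span_subvP => b gb; apply/cent1vP/gens_comm.
have gens_cent : (<<gens>> <= 'C(<<gens>>))%VS.
  by apply/span_subvP => a /span_cent; rewrite subv_cent1.
have agenv_cent (W : {vspace permalg F n}) :
    (<<gens>> <= 'C(W))%VS -> (agenv <<gens>> <= 'C(W))%VS.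
  move=> gW; apply: agenv_sub_modl; first by rewrite -memvE centv1.
  by apply: subv_trans (prodvSl _ gW) _; apply: asubv.
have := agenv_cent _ gens_cent; rewrite centvC => /agenv_cent/centvsP comm_all.
by move=> xB yB; apply: comm_all.
Qed.

Theorem theorem6p18 (R : realType) (n : nat) (z : 'I_n -> R[i]) (h p : R[i])
    (h_neq0 : h != 0) :
  forall x y : permalg R[i] n,
    x \in Bethe z h p -> y \in Bethe z h p -> x * y = y * x.
Proof. by move=> x y; apply: Bethe_comm. Qed.
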